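(* Let $L$ be a finite distributive lattice. The following conditions are equivalent: (a) The reduced Gröbner basis of $I_L$ with respect to a rank lexicographic order consists of all Hibi relations in $I_L$. (b) The Hibi relations are indispensable, and $I_L$ has a reduced quadratic Gröbner basis with respect to a rank lexicographic order. (c) $L$ is conditionally URC, and for all $a<b<c$ in $L$ such that $[a,b]$ and $[b,c]$ have complementary sets, it follows that either $[g,c]$ or $[h,c]$ is complemented, where $\{g,h\}$ is the complementary set of $[a,b]$. (d) $L$ is isomorphic to a chain ladder without critical corners.
   Context: Fix a field $K$ and let $T=K[\{z_a : a\in L\}]$ be the polynomial ring with variables indexed by the elements of $L$. The Hibi relation ideal of $L$ is $I_L=(z_az_b-z_{a\wedge b}z_{a\vee b} : a,b\in L)\subset T$. The Hibi relations are the (nonzero) binomials $z_az_b-z_{a\wedge b}z_{a\vee b}$, i.e. those with $a,b\in L$ incomparable; they are regarded up to sign. The Hibi relations are called indispensable if each of them appears (up to sign) in every minimal generating set of $I_L$ consisting of binomials (differences of two monomials). The rank of $a\in L$ is the maximal length of a chain descending from $a$. A rank lexicographic order is a lexicographic order on $T$ induced by a total order of the variables such that $z_a<z_b$ whenever $\operatorname{rank} a<\operatorname{rank} b$. For an interval $[a,b]$ of $L$ and $c,d\in[a,b]$, the set $\{c,d\}$ is a complementary set of $[a,b]$ if $c\vee d=b$, $c\wedge d=a$ and $\{c,d\}\ne\{a,b\}$. An interval is complemented if it admits a complementary set. $L$ is conditionally URC (conditionally uniquely relatively complemented) if for each interval $[a,b]$ of $L$, a complementary set of $[a,b]$ is unique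 provided it exists. For an integer $k\ge0$, $[k]_0=\{0,1,\dots,k\}$, and $[m]_0\times[n]_0$ carries the componentwise order. A sublattice of $[m]_0\times[n]_0$ is full if it contains a chain of length $m+n$ (i.e. a chain with $m+n+1$ elements). Let $L$ be a full sublattice of $[m]_0\times[n]_0$ and let $(i,j)\in L$ be such that $(i-1,j),(i+1,j),(i,j+1),(i,j-1)$ also belong to $L$. Then $(i,j)$ is called - an upper corner if $(i-1,j+1)\notin L$ and $(i+1,j-1)\in L$; - a lower corner if $(i-1,j+1)\in L$ and $(i+1,j-1)\notin L$; - a critical corner if $(i-1,j+1)\notin L$ and $(i+1,j-1)\notin L$. Such an $L$ is called a chain ladder if all upper corners and lower corners appear in a chain and, for any two corners $(i,j)\neq(i',j')$ of $L$, one has $i\neq i'$ and $j\neq j'$. *)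

(* Defs.v *)
From HB Require Import structures.
From mathcomp Require Import all_boot all_order all_algebra.
From mathcomp Require Import mpoly.

Set Implicit Arguments.
Unset Strict Implicit.
Unset Printing Implicit Defensive.

Import Order.TTheory GRing.Theory.

Local Open Scope ring_scope.

Definition ideal_gen (R : comNzRingType) (G : R -> Prop) (f : R) : Prop :=
  exists s : seq (R * R),
    (forall p, p \in s -> G p.2) /\ f = \sum_(p <- s) p.1 * p.2.

Definition generates (R : comNzRingType) (G I : R -> Prop) : Prop :=
  forall f, ideal_gen G f <-> I f.

Definition binomial_poly (K : fieldType) (n : nat) (f : {mpoly K[n]}) : Prop :=
  exists u v : 'X_{1..n}, f = 'X_[u] - 'X_[v].

Definition minimal_binomial_generating_set (K : fieldType) (n : nat)
    (I G : {mpoly K[n]} -> Prop) : Prop :=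
  [/\ forall f, G f -> binomial_poly f,
      generates G I
    & forall H : {mpoly K[n]} -> Prop,
        (forall f, H f -> G f) -> generates H I -> forall f, G f -> H f].

Section Groebner.

Variables (K : fieldType) (n : nat).

(* [lt u v] means that the monomial [u] is strictly smaller than [v]. *)
Variable lt : rel 'X_{1..n}.

Definition initial_monomial (f : {mpoly K[n]}) (u : 'X_{1..n}) : Prop :=
  u \in msupp f /\ forall v, v \in msupp f -> v != u -> lt v u.

Definition initial_ideal (I : {mpoly K[n]} -> Prop) : {mpoly K[n]} -> Prop :=
  ideal_gen (fun p => exists f u,
    [/\ I f, initial_monomial f u & p = 'X_[u]]).

(* Since [initial_monomial 0 u] never holds, the elements of [G] are nonzero. *)
Definition groebner_basis (G : seq {mpoly K[n]}) (I : {mpoly K[n]} -> Prop) :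
    Prop :=
  [/\ forall g, g \in G -> I g,
      forall g, g \in G -> g != 0
    & generates (fun p => exists g u,
        [/\ g \in G, initial_monomial g u & p = 'X_[u]]) (initial_ideal I)].

(* In [mpoly], [(u <= v)%MM] is divisibility of monomials. *)
Definition reduced_groebner_basis (G : seq {mpoly K[n]})
    (I : {mpoly K[n]} -> Prop) : Prop :=
  [/\ groebner_basis G I,
      forall g u, g \in G -> initial_monomial g u -> g@_u = 1
    & forall g h u v, g \in G -> h \in G -> g != h ->
        initial_monomial g u -> v \in msupp h -> ~~ (u <= v)%MM].

End Groebner.

Definition is_chain (d : Order.disp_t) (P : finPOrderType d) (C : {set P}) :
    bool :=
  [forall x in C, forall y in C, (x >=< y)%O].

Section Lattice.

Variables (d : Order.disp_t) (L : finTBDistrLatticeType d).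
Implicit Types a b c e g h : L.

(* The length of a chain is its number of elements minus one. *)
Definition rank (a : L) : nat :=
  \max_(C : {set L} | [&& a \in C, is_chain C & [forall x in C, (x <= a)%O]])
    #|C|.-1.

Definition complementary_set (a b : L) (S : {set L}) : Prop :=
  exists c e : L,
    [/\ S = [set c; e], (a <= c <= b)%O && (a <= e <= b)%O,
        (c `|` e)%O = b, (c `&` e)%O = a & S != [set a; b]].

Definition complemented (a b : L) : Prop :=
  exists S : {set L}, complementary_set a b S.

Definition conditionally_URC : Prop :=
  forall (a b : L) (S S' : {set L}), (a <= b)%O ->
    complementary_set a b S -> complementary_set a b S' -> S = S'.

(* A non-strict total order on the variables, indexed by [L], that refines the
   order by rank. *)
Definition rank_order (vle : rel L) : Prop :=
  [/\ reflexive vle, antisymmetric vle, transitive vle, total vle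
    & forall a b, (rank a < rank b)%N -> ~~ vle b a].

Lemma rank_order_exists : exists vle : rel L, rank_order vle.
Proof.
exists (fun a b => (rank a < rank b)%N ||
  ((rank a == rank b) && (enum_rank a <= enum_rank b)%N)).
split.
- by move=> a; rewrite eqxx leqnn orbT.
- move=> a b /andP[].
  case: (ltngtP (rank a) (rank b)) => //= _ ab ba.
  by apply: enum_rank_inj; apply: val_inj; apply/eqP; rewrite eqn_leq ab ba.
- move=> b a c /orP[ab|/andP[/eqP-> ab]] /orP[bc|/andP[/eqP<- bc]].
  + by rewrite (ltn_trans ab bc).
  + by rewrite ab.
  + by rewrite bc.
  + by rewrite eqxx (leq_trans ab bc) orbT.
- by move=> a b; case: (ltngtP (rank a) (rank b)) => //= _; apply: leq_total.
- by move=> a b ab; rewrite ltnNge (ltnW ab) (gtn_eqF ab).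
Qed.

(* The lexicographic order on monomials: the largest variable whose exponents
   differ decides. The exponent of the variable z_a in [u] is
   [u (enum_rank a)]. *)
Definition lex_lt (vle : rel L) : rel 'X_{1..#|L|} := fun u v =>
  [exists a : L, (u (enum_rank a) < v (enum_rank a))%N &&
    [forall b : L, (vle a b && (b != a)) ==>
       (u (enum_rank b) == v (enum_rank b))]].

Section HibiIdeal.

Variable K : fieldType.

Local Notation T := {mpoly K[#|L|]}.

Definition z (a : L) : T := 'X_(enum_rank a).

Definition hibi_binomial (a b : L) : T :=
  z a * z b - z (a `&` b)%O * z (a `|` b)%O.

Definition hibi_relation (f : T) : Prop :=
  exists a b : L, (a >< b)%O /\ f = hibi_binomial a b.

Definition hibi_ideal : T -> Prop :=
  ideal_gen (fun f : T => exists a b : L, f = hibi_binomial a b).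

(* Equality of sets of polynomials, each polynomial being taken up to sign. *)
Definition same_up_to_sign (G H : T -> Prop) : Prop :=
  (forall f, G f -> H f \/ H (- f)) /\ (forall f, H f -> G f \/ G (- f)).

Definition hibi_relations_indispensable : Prop :=
  forall G : T -> Prop, minimal_binomial_generating_set hibi_ideal G ->
    forall f, hibi_relation f -> G f \/ G (- f).

End HibiIdeal.

End Lattice.

Arguments hibi_ideal {d} L K.
Arguments hibi_relation {d} L K.
Arguments hibi_relations_indispensable {d} L K.

(* The componentwise order on {0, .., m} x {0, .., n}. *)
Notation grid m n := ('I_m.+1 *p 'I_n.+1)%type.

Section Ladder.

Variables (m n : nat) (S : {set grid m n}).

Definition full_sublattice : Prop :=
  (forall p q : grid m n, p \in S -> q \in S ->
     (p `&` q)%O \in S /\ (p `|` q)%O \in S) /\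
  (exists C : {set grid m n},
     [/\ C \subset S, is_chain C & #|C| = (m + n).+1]).

(* The point (i, j) may lie outside the grid. *)
Definition at_pos (i j : nat) : bool :=
  [exists p : grid m n, [&& p \in S, p.1 == i :> nat & p.2 == j :> nat]].

(* As the predecessor on [nat] is truncated, i - 1 and j - 1 need i, j > 0. *)
Definition has_neighbours (p : grid m n) : bool :=
  [&& p \in S, (0 < p.1)%N, (0 < p.2)%N &
   [&& at_pos p.1.-1 p.2, at_pos p.1.+1 p.2,
       at_pos p.1 p.2.+1 & at_pos p.1 p.2.-1]].

Definition upper_corner (p : grid m n) : bool :=
  [&& has_neighbours p, ~~ at_pos p.1.-1 p.2.+1 & at_pos p.1.+1 p.2.-1].

Definition lower_corner (p : grid m n) : bool :=
  [&& has_neighbours p, at_pos p.1.-1 p.2.+1 & ~~ at_pos p.1.+1 p.2.-1].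

Definition critical_corner (p : grid m n) : bool :=
  [&& has_neighbours p, ~~ at_pos p.1.-1 p.2.+1 & ~~ at_pos p.1.+1 p.2.-1].

Definition corner (p : grid m n) : bool :=
  [|| upper_corner p, lower_corner p | critical_corner p].

Definition chain_ladder : Prop :=
  [/\ full_sublattice,
      exists C : {set grid m n}, [/\ C \subset S, is_chain C
        & forall p, upper_corner p || lower_corner p -> p \in C]
    & forall p q : grid m n, corner p -> corner q -> p != q ->
        p.1 != q.1 /\ p.2 != q.2].

End Ladder.

Definition lattice_isomorphic (d d' : Order.disp_t)
    (L : finTBDistrLatticeType d) (M : finDistrLatticeType d')
    (S : {set M}) : Prop :=
  exists f : L -> M,
    [/\ injective f, f @: [set: L] = S,
        {morph f : x y / (x `&` y)%O >-> (x `&` y)%O}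
      & {morph f : x y / (x `|` y)%O >-> (x `|` y)%O}].

(* Main.v *)
Require Import Defs.
From mathcomp Require Import all_boot all_order all_algebra.
From mathcomp Require Import mpoly zify.
From Stdlib Require Import Classical ClassicalEpsilon.
From Stdlib Require Import Relation_Operators Operators_Properties.

Set Implicit Arguments.
Unset Strict Implicit.
Unset Printing Implicit Defensive.

Import Order.TTheory GRing.Theory.

Local Open Scope ring_scope.

(** In a rank lexicographic order the initial monomial of the Hibi relation of
    two incomparable elements [c] and [e] is the product of the variables of
    [c `&` e] and [c `|` e]. The relations therefore become rewriting rules:
    replace the lower and upper ends of a complemented interval by a
    complementary pair. The congruence generated by these rules describes the
    ideal: the coefficients of an element of the ideal add up to zero over each
    congruence class ([hibi_ideal_class_sum]), so each of its monomials is
    congruent to another one ([hibi_ideal_support]).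

    From Gröbner basis to indispensability: two complementary sets of one
    interval would give two basis elements with the same initial monomial, so
    the lattice is conditionally URC ([hibi_basis_URC]). Then the class of the
    monomial of an incomparable pair has only two elements, and any binomials
    generating the ideal must contain their difference ([URC_indispensable]).

    From indispensability to complements: if an interval had two complementary
    sets, the relation of one could be replaced by the difference of the two
    products ([indispensable_URC]). If [g, h] is a complementary pair of [a, b],
    and [b, c] is complemented by [k, l], then z_g z_h z_c and z_a z_k z_l are
    congruent, the former being the larger one. A quadratic initial monomial
    divides it, and this can only be z_g z_c or z_h z_c, whose class has a
    second element exactly when the interval is complemented
    ([quadratic_basis_complemented]).

    From complements to ladders: three pairwise incomparable join primes would
    span a Boolean lattice of rank three, so in a conditionally URC lattice they
    are covered by two chains ([URC_width_two], [width_two_chains]). Counting the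
    join primes below an element in each of the chains embeds the lattice in a
    grid as a full sublattice ([URC_embedding]). In coordinates, the condition
    on two consecutive complemented intervals says that a missing upper left
    vertex and a missing lower right vertex cannot face each other
    ([diagonal_closed]); for full sublattices this is equivalent to the
    conditions on corners ([diagonal_chain_ladder], [chain_ladder_diagonal]).

    From ladders to Gröbner basis: a rewriting step moves two points of the grid
    to the other two vertices of the rectangle that they span. It decreases the
    sum of the products of the coordinates of the points, and it is locally
    confluent; two rectangles sharing a vertex always resolve, except that for
    two rectangles placed diagonally the resolution needs [diagonal_closed].
    By Newman's lemma two congruent monomials can be rewritten to a common one
    ([hibi_equiv_joinable]). Hence a monomial that cannot be rewritten is the
    smallest one of its class and is not initial for any element of the ideal
    ([planar_initial_monomial]), so the Hibi relations form a Gröbner basis. *)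

(** * Ideals generated by a set *)

Section IdealGen.

Variable R : comNzRingType.
Implicit Types (A B : R -> Prop) (f g : R).

Lemma ideal_gen_mem A f : A f -> ideal_gen A f.
Proof.
move=> Af; exists [:: (1, f)]; split; last by rewrite big_seq1 mul1r.
by move=> p; rewrite inE => /eqP->.
Qed.

Lemma ideal_gen0 A : ideal_gen A 0.
Proof. by exists [::]; rewrite big_nil. Qed.

Lemma ideal_genD A f g : ideal_gen A f -> ideal_gen A g -> ideal_gen A (f + g).
Proof.
move=> [s [sA ->]] [t [tA ->]]; exists (s ++ t); split; last by rewrite big_cat.
by move=> p; rewrite mem_cat => /orP[/sA|/tA].
Qed.

Lemma ideal_genM A f g : ideal_gen A g -> ideal_gen A (f * g).
Proof.
move=> [s [sA ->]]; exists [seq (f * p.1, p.2) | p <- s]; split.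
  by move=> _ /mapP[p /sA ? ->].
by rewrite big_map big_distrr /=; apply: eq_bigr => p _; rewrite mulrA.
Qed.

Lemma ideal_gen_trans A B f :
  (forall g, A g -> ideal_gen B g) -> ideal_gen A f -> ideal_gen B f.
Proof.
move=> AB [s [sA ->]]; elim: s sA => [|p s IH] sA.
  by rewrite big_nil; apply: ideal_gen0.
rewrite big_cons; apply: ideal_genD.
  by apply/ideal_genM/AB/sA; rewrite mem_head.
by apply: IH => q qs; apply: sA; rewrite inE qs orbT.
Qed.

Lemma ideal_gen_sub A B f :
  (forall g, A g -> B g) -> ideal_gen A f -> ideal_gen B f.
Proof. by move=> AB; apply: ideal_gen_trans => g /AB/ideal_gen_mem. Qed.

Lemma ideal_genN A f : ideal_gen A f -> ideal_gen A (- f).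
Proof. by rewrite -mulN1r; apply: ideal_genM. Qed.

(** A finite generating set contains a minimal one: as long as a proper subset
    still generates, pass to a strictly shorter sequence. *)
Lemma generates_minimal_seq (I : R -> Prop) (s : seq R) :
  generates (fun f => f \in s) I ->
  exists t : seq R, [/\ {subset t <= s}, generates (fun f => f \in t) I &
    forall H : R -> Prop, (forall f, H f -> f \in t) -> generates H I ->
      forall f, f \in t -> H f].
Proof.
have [k] := ubnP (size s); elim: k s => // k IH s; rewrite ltnS => sk sI.
have [mins|] := classic (forall H : R -> Prop, (forall f, H f -> f \in s) ->
  generates H I -> forall f, f \in s -> H f); first by exists s; split.
move=> /not_all_ex_not nmin; case: nmin => H nmin.
have [Hs {}nmin] := imply_to_and _ _ nmin.
have [HI {}nmin] := imply_to_and _ _ nmin.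
case: (not_all_ex_not _ _ nmin) => f {}nmin.
have [fs Hf] := imply_to_and _ _ nmin.
have Hr g : H g -> g \in [seq g <- s | g != f].
  move=> Hg; rewrite mem_filter Hs // andbT.
  by apply/eqP => gf; apply: Hf; rewrite -gf.
have [||t [ts tI tmin]] := IH [seq g <- s | g != f].
- apply: leq_trans sk; rewrite size_filter -(count_predC (pred1 f)).
  rewrite -[X in (X < _)%N]add0n ltn_add2r -has_count.
  by apply/hasP; exists f => /=.
- move=> g; split=> [|/HI]; last exact: ideal_gen_sub.
  by move=> h; apply/sI; apply: ideal_gen_sub h => h; rewrite mem_filter => /andP[].
by exists t; split=> // g /ts; rewrite mem_filter => /andP[].
Qed.

End IdealGen.

(** * Monomials *)

Section Monomials.

Variables (K : fieldType) (n : nat).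
Implicit Types (f : {mpoly K[n]}) (u v w : 'X_{1..n}).

(** If a monomial is a combination of monomials, then the coefficient at it of
    one of the terms does not vanish, so one of the monomials divides it. *)
Lemma ideal_gen_monomial (A : 'X_{1..n} -> Prop) u :
  ideal_gen (fun p : {mpoly K[n]} => exists v, A v /\ p = 'X_[v]) 'X_[u] <->
  exists2 v, A v & (v <= u)%MM.
Proof.
split=> [[s [sA us]]|[v Av vu]]; last first.
  rewrite -(submK vu) mpolyXD; apply: ideal_genM; apply: ideal_gen_mem.
  by exists v.
have: ('X_[u] : {mpoly K[n]})@_u != 0 by rewrite mcoeffX eqxx oner_neq0.
rewrite us raddf_sum /= => nz.
have [p ps pu] : exists2 p, p \in s & (p.1 * p.2)@_u != 0.
  apply/hasP; apply: contraNT nz => /hasPn h; rewrite big_seq big1 //.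
  by move=> p /h; rewrite negbK => /eqP.
have [v [Av p2]] := sA _ ps; exists v => //.
move: pu; rewrite p2 -mcoeff_msupp => /msuppM_le /allpairsP[[a b] /= [_]].
by rewrite msuppX inE => /eqP-> ->; apply: lem_addl.
Qed.

End Monomials.

(** * Complementary sets in a distributive lattice *)

Section Complements.

Variables (d : Order.disp_t) (L : finTBDistrLatticeType d).
Implicit Types a b c e g h : L.

Lemma rank_lt a b : (a < b)%O -> (rank a < rank b)%N.
Proof.
move=> ab; rewrite {1}/rank.
pose P (C : {set L}) := [&& a \in C, is_chain C & [forall x in C, (x <= a)%O]].
have P1 : P [set a].
  rewrite /P set11 /=; apply/andP; split; apply/forall_inP => x.
    by move=> /set1P->; apply/forall_inP => y /set1P->;
      rewrite /Order.comparable lexx.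
  by move=> /set1P->.
rewrite (bigop.bigmax_eq_arg _ P1); case: arg_maxnP => //= C /and3P[aC Cch Ca] _.
have bC : b \notin C.
  by apply/negP => /(forall_inP Ca) ba; have := lt_le_trans ab ba; rewrite ltxx.
have -> : (#|C|.-1).+1 = #|b |: C|.-1.
  by rewrite cardsU1 bC /= prednK //; apply/card_gt0P; exists a.
apply: (bigop.leq_bigmax_cond (F := fun C : {set L} => #|C|.-1)).
apply/and3P; split; first by rewrite setU11.
  apply/forall_inP => x xC; apply/forall_inP => y yC.
  have leb z : z \in C -> (z <= b)%O.
    by move=> /(forall_inP Ca) za; apply: le_trans za (ltW ab).
  move: xC yC; rewrite !inE /Order.comparable.
  move=> /orP[/eqP->|xC] /orP[/eqP->|yC]; rewrite ?lexx ?leb ?orbT //.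
  by move/forall_inP: Cch => /(_ _ xC)/forall_inP/(_ _ yC).
apply/forall_inP => x; rewrite !inE => /orP[/eqP->//|/(forall_inP Ca) xa].
exact: le_trans xa (ltW ab).
Qed.

Lemma incomparableP c e : (c >< e)%O ->
  [/\ (c `&` e < c)%O, (c `&` e < e)%O, (c < c `|` e)%O & (e < c `|` e)%O].
Proof.
rewrite /Order.comparable negb_or => /andP[ce ec].
split; rewrite lt_neqAle ?leIl ?leIr ?leUl ?leUr andbT.
- by apply: contraNneq ce => <-; apply: leIr.
- by apply: contraNneq ec => <-; apply: leIl.
- by apply: contraNneq ec => ->; apply: leUr.
- by apply: contraNneq ce => ->; apply: leUl.
Qed.

Lemma set2_inj a b c e : [set a; b] = [set c; e] ->
  a = c /\ b = e \/ a = e /\ b = c.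
Proof.
have set2I x y y' : [set x; y] = [set x; y'] :> {set L} -> y = y'.
  move=> /setP E; have := E y; have := E y'; rewrite !inE !eqxx !orbT.
  by case: eqP => [->|_ /eqP->//] _; case: eqP => // ->.
move=> E; have : a \in [set c; e] by rewrite -E set21.
rewrite !inE => /orP[] /eqP aE; move: E; rewrite aE.
  by move=> /set2I->; left.
by rewrite [X in _ = X]setUC => /set2I->; right.
Qed.

Lemma complementary_setP a b c e : complementary_set a b [set c; e] <->
  [/\ (c >< e)%O, (c `&` e)%O = a & (c `|` e)%O = b].
Proof.
split=> [[c' [e' [S _ jb ma Sab]]]|[ce <- <-]]; last first.
  have [l1 l2 l3 l4] := incomparableP ce.
  exists c, e; rewrite leIl leIr leUl leUr; split=> //.
  by apply/eqP => /set2_inj[[E _]|[E _]]; move: l1 l3; rewrite -E ltxx.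
have {}ce' : (c' >< e')%O.
  apply: contraNN Sab; rewrite S -jb -ma => /orP[] /[dup].
    by move=> /join_idPr-> /meet_idPl->.
  by rewrite setUC => /join_idPl-> /meet_idPr->.
have [[-> ->]//|[-> ->]] := set2_inj S.
by rewrite meetC joinC comparable_sym.
Qed.

Lemma complementedP a b : complemented a b <->
  exists c e, [/\ (c >< e)%O, (c `&` e)%O = a & (c `|` e)%O = b].
Proof.
split=> [[S] /[dup] H [c [e [E _ _ _ _]]]|[c [e H]]].
  by exists c, e; apply/complementary_setP; rewrite -E.
by exists [set c; e]; apply/complementary_setP.
Qed.

Lemma conditionally_URCP : conditionally_URC L <->
  forall c e c' e', (c >< e)%O -> (c' >< e')%O ->
    (c `&` e)%O = (c' `&` e')%O -> (c `|` e)%O = (c' `|` e')%O ->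
    [set c; e] = [set c'; e'].
Proof.
split=> [U c e c' e' ce ce' E E'|U a b S S' _ H H'].
  apply: (U (c `&` e)%O (c `|` e)%O); first by rewrite (le_trans (leIl _ _)) ?leUl.
    exact/complementary_setP.
  by apply/complementary_setP; rewrite E E'.
have [c [e [E _ _ _ _]]] := H; have [c' [e' [E' _ _ _ _]]] := H'.
move: H H'; rewrite E E' => /complementary_setP[ce <- <-].
by move=> /complementary_setP[ce' m j]; apply: U.
Qed.

End Complements.

(** * The congruence on monomials defined by the Hibi relations *)

Section Congruence.

Variables (d : Order.disp_t) (L : finTBDistrLatticeType d).
Implicit Types a b c e g h : L.
Implicit Types u v w : 'X_{1..#|L|}.

Definition pair_mnm a b : 'X_{1..#|L|} :=
  (U_(enum_rank a) + U_(enum_rank b))%MM.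

Lemma mnm1_rankE a c : U_(enum_rank a)%MM (enum_rank c) = (a == c) :> nat.
Proof. by rewrite mnm1E (inj_eq enum_rank_inj). Qed.

Lemma pair_mnmE a b c : pair_mnm a b (enum_rank c) = ((a == c) + (b == c))%N.
Proof. by rewrite mnmDE !mnm1_rankE. Qed.

Lemma mnm_rankP u v : (forall c, u (enum_rank c) = v (enum_rank c)) -> u = v.
Proof. by move=> uv; apply/mnmP => i; rewrite -(enum_valK i). Qed.

Lemma mdeg_pair_mnm a b : mdeg (pair_mnm a b) = 2%N.
Proof. by rewrite mdegD !mdeg1. Qed.

Lemma pair_mnmC a b : pair_mnm a b = pair_mnm b a.
Proof. exact: addmC. Qed.

Lemma pair_mnm_inj a b c e : pair_mnm a b = pair_mnm c e ->
  a = c /\ b = e \/ a = e /\ b = c.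
Proof.
move=> E.
have {}E x : ((a == x) + (b == x) = (c == x) + (e == x))%N by rewrite -!pair_mnmE E.
have := E a; rewrite eqxx; have [ca|ca] := eqVneq c a.
  by have := E b; rewrite ca eqxx; case: (e =P b) => [->|_]; [left|case: (a == b)].
have [ea _|_] := eqVneq e a; last by case: (b == a).
have := E b; rewrite ea eqxx.
by case: (c =P b) => [->|_]; [right|case: (a == b)].
Qed.

Lemma pair_mnm_complement c e : (c >< e)%O ->
  pair_mnm c e != pair_mnm (c `&` e)%O (c `|` e)%O.
Proof.
move=> /incomparableP[l1 _ l3 _].
by apply/eqP => /pair_mnm_inj[[E _]|[E _]]; move: l1 l3; rewrite -E ltxx.
Qed.

Lemma pair_mnm_comparable c e : (c >=< e)%O ->
  pair_mnm (c `&` e)%O (c `|` e)%O = pair_mnm c e.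
Proof.
move=> /orP[] /[dup]; first by move=> /join_idPr-> /meet_idPl->.
by rewrite pair_mnmC => /join_idPl-> /meet_idPr->.
Qed.

Definition hibi_step u v : Prop := exists w c e,
  [/\ (c >< e)%O, u = (w + pair_mnm (c `&` e)%O (c `|` e)%O)%MM
    & v = (w + pair_mnm c e)%MM].

Definition hibi_equiv := clos_refl_sym_trans _ hibi_step.

Lemma hibi_equiv_swap w c e :
  hibi_equiv (w + pair_mnm c e)%MM (w + pair_mnm (c `&` e)%O (c `|` e)%O)%MM.
Proof.
have [ce|ce] := boolP (c >=< e)%O.
  by rewrite pair_mnm_comparable //; apply: rst_refl.
by apply/rst_sym/rst_step; exists w, c, e.
Qed.

Lemma hibi_equiv_deg u v : hibi_equiv u v -> mdeg u = mdeg v.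
Proof.
elim=> {u v} [u v [w [c [e [_ -> ->]]]]|//|u v _ -> //|u v w _ -> _ -> //].
by rewrite !mdegD !mdeg1.
Qed.

(** A relation involves monomials of degree at least two. *)
Lemma hibi_equiv_deg1 u v : hibi_equiv u v -> (mdeg u < 2)%N -> u = v.
Proof.
move=> uv; elim: {u v} uv (hibi_equiv_deg uv).
- by move=> u v [w [c [e [_ -> _]]]] _; rewrite mdegD mdeg_pair_mnm; lia.
- by [].
- by move=> u v /hibi_equiv_deg uv IH _ v1; rewrite IH // uv.
- move=> u v w /hibi_equiv_deg uv IH1 /hibi_equiv_deg vw IH2 _ u1.
  by rewrite IH1 // IH2 // -uv.
Qed.

(** In degree two a step involves all of the monomial, so the meet and the join
    of the two factors are invariants of the class. *)
Lemma hibi_equiv_pair a b v : hibi_equiv (pair_mnm a b) v ->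
  exists c e, [/\ v = pair_mnm c e, (c `&` e)%O = (a `&` b)%O
    & (c `|` e)%O = (a `|` b)%O].
Proof.
pose Q u v := forall a b, u = pair_mnm a b ->
  exists c e, [/\ v = pair_mnm c e, (c `&` e)%O = (a `&` b)%O
    & (c `|` e)%O = (a `|` b)%O].
suff QE u : hibi_equiv u v -> Q u v /\ Q v u by move=> /QE[] /(_ a b erefl).
have pair0 w c e a' b' : (w + pair_mnm c e)%MM = pair_mnm a' b' ->
    w = 0%MM /\ pair_mnm c e = pair_mnm a' b'.
  move=> E; have /eqP := congr1 (@mdeg _) E.
  rewrite mdegD !mdeg_pair_mnm -[X in _ == X]add0n eqn_add2r mdeg_eq0 => /eqP w0.
  by move: E; rewrite w0 add0m; split.
elim=> {u v} [u v [w [c [e [_ -> ->]]]]|u|u v _ []//|u v w _ [H1 H2] _ [H3 H4]].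
- split=> a' b' E.
    have [w0 wE] := pair0 _ _ _ _ _ E.
    have le : (c `&` e <= c `|` e)%O by rewrite (le_trans (leIl _ _)) ?leUl.
    exists c, e; rewrite w0 add0m; split=> //.
      by case: (pair_mnm_inj wE) => -[<- <-]; rewrite (meet_idPl le, meet_idPr le).
    by case: (pair_mnm_inj wE) => -[<- <-]; rewrite (join_idPl le, join_idPr le).
  have [w0 wE] := pair0 _ _ _ _ _ E.
  have le : (c `&` e <= c `|` e)%O by rewrite (le_trans (leIl _ _)) ?leUl.
  exists (c `&` e)%O, (c `|` e)%O; rewrite w0 add0m (meet_idPl le) (join_idPr le);
    split=> //.
    by case: (pair_mnm_inj wE) => -[-> ->] //; rewrite meetC.
  by case: (pair_mnm_inj wE) => -[-> ->] //; rewrite joinC.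
- by split=> a' b' ->; exists a', b'.
- split=> a' b'.
    by move=> /H1[c [e [/H3[c' [e' [-> <- <-]]] <- <-]]]; exists c', e'.
  by move=> /H4[c [e [/H2[c' [e' [-> <- <-]]] <- <-]]]; exists c', e'.
Qed.

End Congruence.

(** * The Hibi ideal and the rank lexicographic order *)

Section HibiIdealTheory.

Variables (K : fieldType) (d : Order.disp_t) (L : finTBDistrLatticeType d).
Implicit Types a b c e : L.
Implicit Types u v w : 'X_{1..#|L|}.
Implicit Types f : {mpoly K[#|L|]}.

Lemma hibi_binomialE a b : hibi_binomial K a b =
  'X_[pair_mnm a b] - 'X_[pair_mnm (a `&` b)%O (a `|` b)%O].
Proof. by rewrite !mpolyXD. Qed.

Lemma hibi_binomial_comparable a b : (a >=< b)%O -> hibi_binomial K a b = 0.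
Proof. by move=> ab; rewrite hibi_binomialE pair_mnm_comparable // subrr. Qed.

Lemma mcoeff_sum_mpolyX (chi : pred 'X_{1..#|L|}) k u :
  \sum_(m : 'X_{1..#|L| < k} | chi m) ('X_[u] : {mpoly K[#|L|]})@_m =
  (chi u && (mdeg u < k)%N)%:R.
Proof.
case: (ltnP (mdeg u) k) => uk; last first.
  rewrite andbF big1 // => m _; rewrite mcoeffX; case: eqP => // um.
  by have := bmdeg m; rewrite -um ltnNge uk.
rewrite andbT; under eq_bigr => m _ do rewrite mcoeffX.
rewrite big_mkcond /= (bigD1 (BMultinom uk)) //= eqxx big1 ?addr0.
  by case: (chi u).
move=> m mu; case: (chi m) => //; case: eqP => // um.
by case/eqP: mu; apply: val_inj.
Qed.

(** Each Hibi relation is a difference of two congruent monomials, so the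
    coefficients of an element of the ideal add up to zero over every
    congruence class. The bound [k] on the degree makes the sum finite. *)
Lemma hibi_ideal_class_sum (chi : pred 'X_{1..#|L|}) k f :
  (forall u v, hibi_step u v -> chi u = chi v) -> hibi_ideal L K f ->
  \sum_(m : 'X_{1..#|L| < k} | chi m) f@_m = 0.
Proof.
move=> chiE [s [sH ->]]; under eq_bigr => m _ do rewrite raddf_sum /=.
rewrite exchange_big /= big_seq big1 // => p /sH[a [b ->]].
have [ab|ab] := boolP (a >=< b)%O.
  by rewrite hibi_binomial_comparable // mulr0 big1 // => m _; rewrite mcoeff0.
rewrite [p.1]mpolyE hibi_binomialE big_distrl /=.
under eq_bigr => m _ do rewrite raddf_sum /=.
rewrite exchange_big /= big1 // => w _.
under eq_bigr => m _ do rewrite -scalerAl mcoeffZ mulrBr -!mpolyXD mcoeffB.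
rewrite -big_distrr /= sumrB !mcoeff_sum_mpolyX !mdegD !mdeg1.
rewrite (chiE (w + pair_mnm (a `&` b)%O (a `|` b)%O)%MM (w + pair_mnm a b)%MM).
  by rewrite subrr mulr0.
by exists w, a, b.
Qed.

(** Were [u] the only monomial of [f] in its class, the sum of the coefficients
    over the class would be the coefficient of [u]. *)
Lemma hibi_ideal_support f u : hibi_ideal L K f -> u \in msupp f ->
  exists v, [/\ v \in msupp f, v != u & hibi_equiv u v].
Proof.
move=> If uf; apply: NNPP => H.
(* the indicator function of the class, by the excluded middle *)
pose chi v : bool := if excluded_middle_informative (hibi_equiv u v) then true else false.
have chiP v : reflect (hibi_equiv u v) (chi v).
  by rewrite /chi; case: excluded_middle_informative => ?; constructor.
have chiE v w : hibi_step v w -> chi v = chi w.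
  move=> vw; apply/chiP/chiP => uv; apply: rst_trans uv _; last apply: rst_sym.
    exact: rst_step.
  exact: rst_step.
have := hibi_ideal_class_sum (msize f) chiE If.
have uk : (mdeg u < msize f)%N by apply: msize_mdeg_lt.
rewrite (bigD1 (BMultinom uk)) /=; last by apply/chiP/rst_refl.
rewrite big1 ?addr0 => [/eqP|m /andP[/chiP um mu]].
  by rewrite mcoeff_eq0 uf.
apply/eqP; rewrite mcoeff_eq0; apply/negP => mf; apply: H; exists m; split=> //.
Qed.

Lemma hibi_equiv_ideal u v : hibi_equiv u v -> hibi_ideal L K ('X_[u] - 'X_[v]).
Proof.
elim=> {u v} [u v [w [c [e [_ -> ->]]]]|u|u v _ IH|u v w _ IH1 _ IH2].
- rewrite !(mpolyXD _ w) -mulrBr; apply: ideal_genM.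
  by rewrite -opprB -hibi_binomialE; apply/ideal_genN/ideal_gen_mem; exists c, e.
- by rewrite subrr; apply: ideal_gen0.
- by rewrite -opprB; apply: ideal_genN.
- by rewrite -(subrKA 'X_[v]); apply: ideal_genD.
Qed.

Lemma msupp_binomial u v : u != v ->
  msupp ('X_[u] - 'X_[v] : {mpoly K[#|L|]}) =i [:: u; v].
Proof.
move=> uv x; rewrite mcoeff_msupp mcoeffB !mcoeffX !inE ![x == _]eq_sym.
have [ux|xu] := eqVneq u x;
  first by rewrite -ux (eq_sym v) (negPf uv) subr0 oner_neq0.
by rewrite /= mulr0n sub0r oppr_eq0; case: (v =P x) => _; rewrite ?oner_neq0 ?eqxx.
Qed.

Lemma hibi_relation_inj a b c e : (a >< b)%O -> (c >< e)%O ->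
  hibi_binomial K a b = hibi_binomial K c e \/
  hibi_binomial K a b = - hibi_binomial K c e -> [set a; b] = [set c; e].
Proof.
move=> ab ce H.
suff : pair_mnm a b = pair_mnm c e.
  by move=> /pair_mnm_inj[[-> ->]//|[-> ->]]; rewrite setUC.
have suppE : msupp (hibi_binomial K a b) =i msupp (hibi_binomial K c e).
  by case: H => -> //; apply/perm_mem/msuppN.
have [] := (suppE (pair_mnm a b), suppE (pair_mnm c e)).
rewrite !hibi_binomialE !msupp_binomial ?pair_mnm_complement //.
rewrite !inE !eqxx /= => /esym/orP[/eqP//|/eqP/pair_mnm_inj E] _.
have le : (c `&` e <= c `|` e)%O by rewrite (le_trans (leIl _ _)) ?leUl.
by case/negP: ab; case: E => -[-> ->]; rewrite /Order.comparable le ?orbT.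
Qed.

Section RankLex.

Variable vle : rel L.
Hypothesis vle_rank : rank_order vle.

Lemma lex_lt_irr u : lex_lt vle u u = false.
Proof. by apply/existsP => -[a]; rewrite ltnn. Qed.

Lemma lex_lt_trans : transitive (lex_lt vle).
Proof.
have [vrefl vanti vtrans vtot _] := vle_rank.
move=> v u w /existsP[a /andP[uva /forallP Ha]] /existsP[b /andP[vwb /forallP Hb]].
have {}Ha c : vle a c -> c != a -> u (enum_rank c) = v (enum_rank c).
  by move=> ac ca; have := Ha c; rewrite ac ca => /eqP.
have {}Hb c : vle b c -> c != b -> v (enum_rank c) = w (enum_rank c).
  by move=> bc cb; have := Hb c; rewrite bc cb => /eqP.
apply/existsP; have [ab|nab] := eqVneq a b.
  subst b; exists a; rewrite (ltn_trans uva vwb).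
  by apply/forallP => c; apply/implyP => /andP[ac ca]; rewrite Ha // Hb.
have [ab|ba] := orP (vtot a b).
  have nba : b != a by rewrite eq_sym.
  exists b; rewrite Ha // vwb.
  apply/forallP => c; apply/implyP => /andP[bc cb].
  rewrite Ha ?Hb // ?(vtrans _ _ _ ab bc) //.
  by apply: contraNneq nab => ca; apply/eqP/vanti; rewrite ab -ca.
exists a; rewrite -Hb // uva.
apply/forallP => c; apply/implyP => /andP[ac ca].
rewrite Ha ?Hb // ?(vtrans _ _ _ ba ac) //.
by apply: contraNneq nab => cb; apply/eqP/vanti; rewrite ba -cb ac.
Qed.

Lemma lex_lt_top a u v : (v (enum_rank a) < u (enum_rank a))%N ->
  (forall b, b != a -> u (enum_rank b) != v (enum_rank b) ->
    (rank b < rank a)%N) -> lex_lt vle v u.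
Proof.
have [_ _ _ _ vrank] := vle_rank.
move=> va H; apply/existsP; exists a; rewrite va.
apply/forallP => b; apply/implyP => /andP[ab ba].
by apply: contraTT ab; rewrite eq_sym => /(H _ ba)/vrank.
Qed.

(** The join has larger rank than the three other elements of the relation. *)
Lemma lex_lt_step u v : hibi_step u v -> lex_lt vle v u.
Proof.
move=> [w [c [e [ce -> ->]]]]; have [l1 _ l3 l4] := incomparableP ce.
apply: (@lex_lt_top (c `|` e)%O).
  by rewrite !(mnmDE, pair_mnmE) eqxx (lt_eqF l3) (lt_eqF l4); lia.
move=> b bj; rewrite !(mnmDE, pair_mnmE) [(_ `|` _)%O == b]eq_sym (negPf bj).
have [<- _|_] := eqVneq (c `&` e)%O b; first exact: rank_lt (lt_trans l1 l3).
have [<- _|_] := eqVneq c b; first exact: rank_lt l3.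
have [<- _|_] := eqVneq e b; first exact: rank_lt l4.
by rewrite eqxx.
Qed.

Lemma initial_monomial_unique f u v :
  initial_monomial (lex_lt vle) f u -> initial_monomial (lex_lt vle) f v -> u = v.
Proof.
move=> [uf fu] [vf fv]; apply/eqP; apply: contraT => uv.
have := lex_lt_trans (fv _ uf uv) (fu v vf _).
by rewrite lex_lt_irr eq_sym; apply.
Qed.

Lemma initial_monomialN f u :
  initial_monomial (lex_lt vle) (- f) u <-> initial_monomial (lex_lt vle) f u.
Proof.
have sE := perm_mem (msuppN f).
split=> -[uf fu]; split; rewrite ?sE // -?sE // => v; first by rewrite -sE;
  apply: fu.
by rewrite sE; apply: fu.
Qed.

Lemma initial_hibi c e : (c >< e)%O -> initial_monomial (lex_lt vle)
  (hibi_binomial K c e) (pair_mnm (c `&` e)%O (c `|` e)%O).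
Proof.
move=> ce; rewrite hibi_binomialE.
have sE := msupp_binomial (pair_mnm_complement ce).
split; first by rewrite sE !inE eqxx orbT.
move=> v; rewrite sE !inE => /orP[]/eqP-> //; last by rewrite eqxx.
move=> _; apply: lex_lt_step; exists 0%MM, c, e; rewrite !add0m; split=> //.
Qed.

(** * From the Gröbner basis of Hibi relations to indispensability *)

Section HibiBasis.

Variable G : seq {mpoly K[#|L|]}.
Hypothesis Gred : reduced_groebner_basis (lex_lt vle) G (hibi_ideal L K).
Hypothesis Ghibi : same_up_to_sign (fun g => g \in G) (hibi_relation L K).

Lemma hibi_basis_msize g : g \in G -> msize g = 3%N.
Proof.
suff H : forall a b, (a >< b)%O -> msize (hibi_binomial K a b) = 3%N.
  have [GH _] := Ghibi; move=> /GH[] [a [b [ab E]]]; first by rewrite E H.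
  by rewrite -[g]opprK msizeN E H.
move=> a b ab; have sE := msupp_binomial (pair_mnm_complement ab).
rewrite hibi_binomialE; apply/eqP; rewrite eqn_leq; apply/andP; split.
  apply/bigmax_leqP_seq => m; rewrite sE !inE => /orP[]/eqP-> _.
    by rewrite /= mdeg_pair_mnm.
  by rewrite /= mdeg_pair_mnm.
apply: (@leq_trans (mdeg (pair_mnm a b)).+1); first by rewrite mdeg_pair_mnm.
by apply: msize_mdeg_lt; rewrite sE mem_head.
Qed.

(** Two complementary sets of an interval would give two basis elements with
    the same initial monomial. *)
Lemma hibi_basis_URC : conditionally_URC L.
Proof.
apply/conditionally_URCP => c e c' e' ce ce' mE jE.
have [_ HG] := Ghibi; have [_ _ redG] := Gred.
have basis a b : (a >< b)%O -> exists g, [/\ g \in G,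
    g = hibi_binomial K a b \/ g = - hibi_binomial K a b &
    initial_monomial (lex_lt vle) g (pair_mnm (a `&` b)%O (a `|` b)%O)].
  move=> ab; have [|gG|gG] := HG (hibi_binomial K a b); first by exists a, b.
    exists (hibi_binomial K a b); split=> //; [by left | exact: initial_hibi].
  exists (- hibi_binomial K a b); split=> //; first by right.
  by apply/initial_monomialN/initial_hibi.
have [g [gG gE gi]] := basis _ _ ce; have [h [hG hE hi]] := basis _ _ ce'.
have [gh|gh] := eqVneq g h.
  apply: hibi_relation_inj => //; subst h.
  case: gE hE => -> [] => [->|->|<-|/oppr_inj->]; [by left|by right| |by left].
  by right; rewrite opprK.
have := redG g h _ _ gG hG gh gi hi.1.
by rewrite mE jE lepm_refl.
Qed.

End HibiBasis.
End RankLex.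
End HibiIdealTheory.

(** * Indispensability and complements *)

Section Indispensable.

Variables (K : fieldType) (d : Order.disp_t) (L : finTBDistrLatticeType d).
Implicit Types a b c e : L.
Implicit Types u v w : 'X_{1..#|L|}.
Implicit Types f : {mpoly K[#|L|]}.

Lemma hibi_ideal_binomial u v : u != v -> hibi_ideal L K ('X_[u] - 'X_[v]) ->
  hibi_equiv u v.
Proof.
move=> uv /hibi_ideal_support H; have [|w []] := H u.
  by rewrite msupp_binomial // mem_head.
rewrite msupp_binomial // !inE => /orP[]/eqP-> //.
by rewrite eqxx.
Qed.

(** Under conditional URC, the class of a quadratic monomial is reduced to the
    two monomials of one Hibi relation. *)
Lemma URC_hibi_equiv_pair a b v : conditionally_URC L -> (a >< b)%O ->
  hibi_equiv (pair_mnm a b) v ->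
  v = pair_mnm a b \/ v = pair_mnm (a `&` b)%O (a `|` b)%O.
Proof.
move=> /conditionally_URCP urc ab /hibi_equiv_pair[c [e [-> mE jE]]].
have [ce|ce] := boolP (c >=< e)%O.
  by right; rewrite -mE -jE pair_mnm_comparable.
left; have [] := set2_inj (urc _ _ _ _ ce ab mE jE) => -[-> ->] //.
exact: pair_mnmC.
Qed.

(** The monomial z_a z_b has to occur in a multiple of some generator. That
    generator is a binomial with a term dividing z_a z_b, and the two terms of
    a binomial of the ideal are congruent, which leaves only the relation. *)
Lemma URC_indispensable : conditionally_URC L -> hibi_relations_indispensable L K.
Proof.
move=> urc G [Gbin Ggen _] f [a [b [ab ->]]]; apply: NNPP => nG.
(* a binomial of the ideal one of whose terms divides z_a z_b is the relation *)
have divides s t : s != t -> hibi_ideal L K ('X_[s] - 'X_[t]) ->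
    (exists w, (pair_mnm a b = w + s)%MM) ->
    s = pair_mnm a b /\ t = pair_mnm (a `&` b)%O (a `|` b)%O.
  move=> st /(hibi_ideal_binomial st) est [w wE].
  have s2 : (1 < mdeg s)%N.
    by rewrite ltnNge; apply: contra st => s1; apply/eqP/(hibi_equiv_deg1 est).
  have w0 : w = 0%MM.
    apply/eqP; rewrite -mdeg_eq0.
    by have := congr1 (@mdeg _) wE; rewrite mdegD mdeg_pair_mnm; lia.
  move: wE; rewrite w0 add0m => sE; split=> //; rewrite -sE in est st.
  by have [tE|//] := URC_hibi_equiv_pair urc ab est; rewrite tE eqxx in st.
have [s [sG fE]] : ideal_gen G (hibi_binomial K a b).
  by apply/Ggen/ideal_gen_mem; exists a, b.
have : (hibi_binomial K a b)@_(pair_mnm a b) != 0.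
  rewrite -mcoeff_msupp hibi_binomialE msupp_binomial ?mem_head //.
  exact: pair_mnm_complement.
rewrite fE raddf_sum /=; apply/negP; rewrite negbK big_seq big1 // => p ps.
have Gp := sG _ ps; have [u [v pE]] := Gbin _ Gp.
have Ip : hibi_ideal L K ('X_[u] - 'X_[v]) by rewrite -pE; apply/Ggen/ideal_gen_mem.
have [uv|uv] := eqVneq u v; first by rewrite pE uv subrr mulr0 mcoeff0.
apply/eqP; rewrite mcoeff_eq0; apply/negP => /msuppM_le/allpairsP[[m1 m2] /= [_]].
rewrite pE msupp_binomial // !inE => /orP[]/eqP-> mE; apply: nG.
  have [uE vE] := divides u v uv Ip (ex_intro _ _ mE).
  by left; rewrite hibi_binomialE -vE -uE -pE.
have [||vE uE] := divides v u _ _ (ex_intro _ _ mE); first by rewrite eq_sym.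
  by have := ideal_genN Ip; rewrite opprB.
by right; rewrite hibi_binomialE -vE -uE opprB -pE.
Qed.

(** If z_c z_e and z_c' z_e' lie in one class besides z_a z_b, then the
    relation on z_c z_e can be replaced by z_c z_e - z_c' z_e'. *)
Lemma indispensable_URC : hibi_relations_indispensable L K -> conditionally_URC L.
Proof.
move=> ind; apply/conditionally_URCP => c e c' e' ce ce' mE jE.
apply/eqP; apply: contraT => ne.
pose u := pair_mnm c e; pose v := pair_mnm c' e'.
have uv : u != v.
  by apply: contraNneq ne => /pair_mnm_inj[[-> ->]|[-> ->]]//; rewrite setUC.
pose s := ('X_[u] - 'X_[v]) :: [seq hibi_binomial K p.1 p.2 |
  p <- enum {: L * L} & (p.1 >< p.2)%O && ([set p.1; p.2] != [set c; e])].
have sH a b : (a >< b)%O -> [set a; b] != [set c; e] -> hibi_binomial K a b \in s.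
  move=> ab abce; rewrite inE; apply/orP; right; apply/mapP; exists (a, b) => //.
  by rewrite mem_filter ab abce mem_enum.
have sP f : f \in s -> f = 'X_[u] - 'X_[v] \/ exists a b,
    [/\ (a >< b)%O, [set a; b] != [set c; e] & f = hibi_binomial K a b].
  rewrite inE => /orP[/eqP->|/mapP[[a b]]]; first by left.
  by rewrite mem_filter /= => /andP[/andP[ab abce] _] ->; right; exists a, b.
have sI : generates (fun f => f \in s) (hibi_ideal L K).
  move=> f; split; apply: ideal_gen_trans => {f} f.
    move=> /sP[->|[a [b [_ _ ->]]]]; last by apply: ideal_gen_mem; exists a, b.
    apply: hibi_equiv_ideal; rewrite -[u]add0m -[v]add0m.
    apply: rst_trans (hibi_equiv_swap _ _ _) _; rewrite mE jE.
    exact/rst_sym/hibi_equiv_swap.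
  move=> [a [b ->]]; have [ab|ab] := boolP (a >=< b)%O.
    by rewrite hibi_binomial_comparable //; apply: ideal_gen0.
  have [E|ab'] := eqVneq [set a; b] [set c; e]; last by apply/ideal_gen_mem/sH.
  have -> : hibi_binomial K a b = ('X_[u] - 'X_[v]) + hibi_binomial K c' e'.
    rewrite !hibi_binomialE -mE -jE subrKA.
    by case: (set2_inj E) => -[-> ->] //; rewrite pair_mnmC meetC joinC.
  apply: ideal_genD; apply: ideal_gen_mem; first exact: mem_head.
  by apply: sH; rewrite // eq_sym.
have [t [ts tI tmin]] := generates_minimal_seq sI.
have nt f : f \in t -> f = hibi_binomial K c e \/ f = - hibi_binomial K c e -> False.
  move=> /ts/sP[->|[a [b [ab abce ->]]]] E; last first.
    by case/eqP: abce; apply: (hibi_relation_inj ab ce E).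
  pose w := pair_mnm (c `&` e)%O (c `|` e)%O.
  have : w \in msupp ('X_[u] - 'X_[v] : {mpoly K[#|L|]}).
    case: E => ->; rewrite ?(perm_mem (msuppN _)) hibi_binomialE.
      by rewrite msupp_binomial ?pair_mnm_complement // !inE eqxx orbT.
    by rewrite msupp_binomial ?pair_mnm_complement // !inE eqxx orbT.
  rewrite msupp_binomial // !inE ![w == _]eq_sym (negPf (pair_mnm_complement ce)).
  by rewrite /w mE jE (negPf (pair_mnm_complement ce')).
have tmb : minimal_binomial_generating_set (hibi_ideal L K) (fun f => f \in t).
  split=> // f /ts/sP[->|[a [b [_ _ ->]]]]; first by exists u, v.
  by rewrite hibi_binomialE; eexists; eexists.
have [|/nt|/nt] := ind _ tmb (hibi_binomial K c e); first by exists c, e.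
  by case; left.
by case; right.
Qed.

Section QuadraticBasis.

Variable vle : rel L.
Hypothesis vle_rank : rank_order vle.

(** The monomial z_c z_g z_h is congruent to the smaller z_a z_k z_l, where k, l
    is a complementary pair of the interval from b to c, hence it is divisible
    by the initial monomial of a basis element. This is not z_g z_h, since the
    only other monomial in the class of z_g z_h is z_a z_b, which is larger. *)
Lemma quadratic_basis_complemented (G : seq {mpoly K[#|L|]}) a b c g h :
  conditionally_URC L ->
  reduced_groebner_basis (lex_lt vle) G (hibi_ideal L K) ->
  (forall g, g \in G -> msize g = 3%N) -> (b < c)%O ->
  complemented b c -> complementary_set a b [set g; h] ->
  complemented g c \/ complemented h c.
Proof.
move=> urc [[GI _ Ggb] _ _] G3 bc /complementedP[k [l [kl klb klc]]].
move=> /complementary_setP[gh gha ghb].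
have [l1 l2 l3 l4] := incomparableP gh; rewrite gha ghb in l1 l2 l3 l4.
have [m1 m2 m3 m4] := incomparableP kl; rewrite klb klc in m1 m2 m3 m4.
pose u := (U_(enum_rank c) + pair_mnm g h)%MM.
pose v := (U_(enum_rank a) + pair_mnm k l)%MM.
have uv : hibi_equiv u v.
  apply: rst_trans (hibi_equiv_swap _ _ _) _; rewrite gha ghb.
  apply: rst_sym; apply: rst_trans (hibi_equiv_swap _ _ _) _; rewrite klb klc.
  suff -> : (U_(enum_rank a) + pair_mnm b c = U_(enum_rank c) + pair_mnm a b)%MM.
    exact: rst_refl.
  by rewrite /pair_mnm addmA [RHS]addmC.
have ne x : (x < c)%O -> (x == c) = false by move=> /lt_eqF.
have vu : lex_lt vle v u.
  apply: (@lex_lt_top _ _ _ vle_rank c).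
    rewrite !(mnmDE, mnm1_rankE) eqxx.
    by rewrite (ne a (lt_trans (lt_trans l1 l3) bc)) (ne k m3) (ne l m4).
  move=> x xc; rewrite !(mnmDE, mnm1_rankE) => H; apply: rank_lt.
  move: H; case: (a =P x) => [<- _|_]; first exact: lt_trans (lt_trans l1 l3) bc.
  case: (g =P x) => [<- _|_]; first exact: lt_trans l3 bc.
  case: (h =P x) => [<- _|_]; first exact: lt_trans l4 bc.
  case: (k =P x) => [<- _|_] //; case: (l =P x) => [<- _|_] //.
  by rewrite [c == x]eq_sym (negPf xc) eqxx.
have ui : initial_monomial (lex_lt vle) ('X_[u] - 'X_[v] : {mpoly K[#|L|]}) u.
  have nuv : u != v by apply: contraTneq vu => ->; rewrite (lex_lt_irr vle).
  split; rewrite ?msupp_binomial ?mem_head // => x.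
  by rewrite msupp_binomial // !inE => /orP[]/eqP-> //; rewrite eqxx.
have [w [f [fG fw]] wu] : exists2 w,
    exists f, f \in G /\ initial_monomial (lex_lt vle) f w & (w <= u)%MM.
  apply/(@ideal_gen_monomial K).
  apply: (@ideal_gen_sub _ (fun p => exists g u,
    [/\ g \in G, initial_monomial (lex_lt vle) g u & p = 'X_[u]])).
    by move=> p [f [w [fG fw ->]]]; exists w; split=> //; exists f.
  apply/Ggb/ideal_gen_mem; exists ('X_[u] - 'X_[v]), u; split=> //.
  exact: hibi_equiv_ideal.
have [w' [w'f w'w ww']] := hibi_ideal_support (GI _ fG) fw.1.
have w2 : mdeg w = 2%N.
  apply/eqP; rewrite eqn_leq -ltnS -(G3 _ fG) msize_mdeg_lt ?fw.1 //= ltnNge.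
  by apply: contra w'w => w1; rewrite (hibi_equiv_deg1 ww').
have /eqP/mdeg1P[i /eqP wi] : mdeg (u - w)%MM = 1%N.
  have u3 : mdeg u = 3%N by rewrite mdegD mdeg_pair_mnm mdeg1.
  by have := mdegD (u - w)%MM w; rewrite submK // u3 w2 => /esym/(@addIn 2 _ 1%N).
have uE : u = (U_(i) + w)%MM by rewrite -wi submK.
have incompl x y : w = pair_mnm x y -> (x <= y)%O -> complemented x y.
  move=> wE xy; move: ww'; rewrite wE => /hibi_equiv_pair[s [t [w'E]]].
  rewrite (meet_idPl xy) (join_idPr xy) => sm sj; apply/complementedP.
  exists s, t; split=> //; apply: contra w'w => st.
  by rewrite w'E wE -sm -sj pair_mnm_comparable.
rewrite -(enum_valK i) in uE; move: (enum_val i) uE => x uE.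
have := mnmDE (enum_rank x) U_(enum_rank x) w.
rewrite -uE !(mnmDE, mnm1_rankE) eqxx.
have [cx _|_] := eqVneq c x.
  subst x; have wE : w = pair_mnm g h by apply: (@addmI _ U_(enum_rank c)%MM);
    rewrite -uE.
  have [w'E|w'E] : w' = pair_mnm g h \/ w' = pair_mnm a b.
    by rewrite -gha -ghb; apply: URC_hibi_equiv_pair; rewrite -?wE.
    by rewrite w'E wE eqxx in w'w.
  have : lex_lt vle w w'.
    rewrite w'E wE; apply: (lex_lt_step vle_rank).
    by exists 0%MM, g, h; rewrite !add0m gha ghb.
  by move=> /(lex_lt_trans vle_rank (fw.2 _ w'f w'w)); rewrite lex_lt_irr.
have [gx _|_] := eqVneq g x.
  subst x; right; apply: incompl (ltW (lt_trans l4 bc));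
    apply: (@addmI _ U_(enum_rank g)%MM).
  by rewrite -uE /u /pair_mnm addmC -addmA.
have [hx _|_] := eqVneq h x; last by rewrite add1n.
subst x; left; apply: incompl (ltW (lt_trans l3 bc));
  apply: (@addmI _ U_(enum_rank h)%MM).
by rewrite -uE /u /pair_mnm addmC [(U_(enum_rank g) + _)%MM]addmC -addmA.
Qed.

End QuadraticBasis.
End Indispensable.

(** * Newman's lemma *)

Section Newman.

Variables (T : Type) (R : T -> T -> Prop) (mu : T -> nat).
Let reach := clos_refl_trans T R.

Hypothesis mu_decr : forall u v, R u v -> (mu v < mu u)%N.
Hypothesis local_confl : forall u v w, R u v -> R u w ->
  exists t, reach v t /\ reach w t.

Lemma newman u v w : reach u v -> reach u w -> exists t, reach v t /\ reach w t.
Proof.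
have [k] := ubnP (mu u); elim: k u v w => // k IH u v w; rewrite ltnS => uk uv uw.
have /clos_rt_rt1n_iff uv' := uv; have /clos_rt_rt1n_iff uw' := uw.
case: uv' uv => [_|v1 {}v uv1 v1v uv]; first by exists w; split=> //;
  apply: rt_refl.
case: uw' uw => [_|w1 {}w uw1 w1w _]; first by exists v; split=> //; apply: rt_refl.
move/clos_rt_rt1n_iff in v1v; move/clos_rt_rt1n_iff in w1w.
have [t1 [v1t w1t]] := local_confl uv1 uw1.
have [t2 [vt2 t12]] := IH v1 _ _ (leq_trans (mu_decr uv1) uk) v1v v1t.
have [t3 [t23 wt3]] := IH w1 _ _ (leq_trans (mu_decr uw1) uk) (rt_trans _ _ _ _ _ w1t t12) w1w.
by exists t3; split=> //; apply: rt_trans vt2 t23.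
Qed.

Lemma church_rosser u v : clos_refl_sym_trans T R u v ->
  exists t, reach u t /\ reach v t.
Proof.
elim=> {u v} [u v uv|u|u v _ [t [ut vt]]|u v w _ [t [ut vt]] _ [s [vs ws]]].
- by exists v; split; [apply: rt_step | apply: rt_refl].
- by exists u; split; apply: rt_refl.
- by exists t.
- have [r [tr sr]] := newman vt vs.
  by exists r; split; [apply: rt_trans ut tr | apply: rt_trans ws sr].
Qed.

End Newman.

(** * Confluence of the Hibi rewriting of a planar lattice *)

(* Proves identities between sums of monomials, exponent by exponent. *)
Ltac mnm_ac := apply/mnmP => ?; rewrite /pair_mnm !mnmDE; clear; lia.

(* Linear arithmetic from the relations between numbers alone. *)
Ltac nat_lia := repeat match goal with
  | H : @eq ?T _ _ |- _ =>
      lazymatch T with nat => fail | bool => fail | _ => clear H end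
  | H : is_true (negb _) |- _ => clear H
  end; lia.

Section Planar.

Variables (d : Order.disp_t) (L : finTBDistrLatticeType d) (x y : L -> nat).
Implicit Types a b c e m j : L.
Implicit Types u v w : 'X_{1..#|L|}.

Lemma mnm_split w a : (0 < w (enum_rank a))%N ->
  exists w0, w = (w0 + U_(enum_rank a))%MM.
Proof.
move=> wa; exists (w - U_(enum_rank a))%MM; rewrite submK //.
by apply/mnm_lepP => i; rewrite mnm1E; case: eqP => // <-.
Qed.

(** An embedding of the lattice into the product of two chains. *)
Definition planar_coordinates : Prop :=
  [/\ {morph x : a b / (a `&` b)%O >-> minn a b},
      {morph x : a b / (a `|` b)%O >-> maxn a b},
      {morph y : a b / (a `&` b)%O >-> minn a b},
      {morph y : a b / (a `|` b)%O >-> maxn a b}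
    & forall a b, x a = x b -> y a = y b -> a = b].

Hypothesis xy : planar_coordinates.

(** The incomparable elements [c] and [e] are the upper left and the lower
    right vertices of a rectangle with lower left vertex [m] and upper right
    vertex [j]. *)
Definition rectangle m c e j : Prop :=
  [/\ x c = x m /\ y c = y j, x e = x j /\ y e = y m & (x m < x j)%N /\ (y m < y j)%N].

Lemma incomparable_rectangle c e : (c >< e)%O ->
  rectangle (c `&` e)%O c e (c `|` e)%O \/ rectangle (c `&` e)%O e c (c `|` e)%O.
Proof.
have [xI xU yI yU xyinj] := xy; rewrite /rectangle xI xU yI yU.
rewrite /Order.comparable negb_or => /andP[nce nec].
have {}nce : ~ (x c <= x e /\ y c <= y e)%N.
  move=> [xce yce]; case/negP: nce; apply/meet_idPl/xyinj; rewrite ?xI ?yI; nat_lia.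
have {}nec : ~ (x e <= x c /\ y e <= y c)%N.
  move=> [xce yce]; case/negP: nec; apply/meet_idPl/xyinj; rewrite ?xI ?yI; nat_lia.
case: (ltnP (x c) (x e)) => H; [left|right]; split; nat_lia.
Qed.

Lemma planar_URC : conditionally_URC L.
Proof.
have [xI xU yI yU xyinj] := xy.
apply/conditionally_URCP => c e c' e' ce ce' mE jE.
have R c1 e1 c2 e2 : rectangle (c `&` e)%O c1 e1 (c `|` e)%O ->
    rectangle (c' `&` e')%O c2 e2 (c' `|` e')%O -> [set c1; e1] = [set c2; e2].
  rewrite -mE -jE => -[[? ?] [? ?] _] [[? ?] [? ?] _].
  have -> : c1 = c2 by apply: xyinj; nat_lia.
  by have -> : e1 = e2 by apply: xyinj; nat_lia.
have [H|H] := incomparable_rectangle ce; have [H'|H'] := incomparable_rectangle ce'.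
- exact: R H H'.
- by rewrite (R _ _ _ _ H H') setUC.
- by rewrite setUC (R _ _ _ _ H H').
- by rewrite setUC (R _ _ _ _ H H') setUC.
Qed.

Local Notation reach := (clos_refl_trans _ (@hibi_step d L)).

(** Degenerate rectangles are allowed: then the two monomials are equal. This
    saves case distinctions below. *)
Lemma reach_rectangle u v w m c e j :
  u = (w + pair_mnm m j)%MM -> v = (w + pair_mnm c e)%MM ->
  x c = x m -> y c = y j -> x e = x j -> y e = y m ->
  (x m <= x j)%N -> (y m <= y j)%N -> reach u v.
Proof.
have [xI xU yI yU xyinj] := xy.
move=> -> -> xc yc xe ye xmj ymj.
have -> : m = (c `&` e)%O by apply: xyinj; rewrite ?xI ?yI; nat_lia.
have -> : j = (c `|` e)%O by apply: xyinj; rewrite ?xU ?yU; nat_lia.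
have [ce|ce] := boolP (c >=< e)%O; last by apply: rt_step; exists w, c, e.
by rewrite pair_mnm_comparable //; apply: rt_refl.
Qed.

Definition joinable u v := exists t, reach u t /\ reach v t.

Lemma joinable_sym u v : joinable u v -> joinable v u.
Proof. by move=> [t [ut vt]]; exists t. Qed.

(** Two rectangles with the same lower left vertex, the first one being the
    narrower. If it is also the lower one, then the monomial of its step
    rewrites to the other one by way of the join [t] of [j] and [c']; if it is
    the higher one, then both rewrite to a monomial containing the meet [t] of
    the upper right vertices. *)
Lemma fork_meet w m c e j c' e' j' :
  rectangle m c e j -> rectangle m c' e' j' ->
  joinable (w + U_(enum_rank j') + pair_mnm c e)%MM
           (w + U_(enum_rank j) + pair_mnm c' e')%MM.
Proof.
have [xI xU yI yU xyinj] := xy.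
wlog : c e j c' e' j' / (x j <= x j')%N.
  move=> H R R'; have [jj'|/ltnW jj'] := leqP (x j) (x j'); first exact: H.
  exact/joinable_sym/H.
move=> xjj [[xc yc] [xe ye] [xmj ymj]] [[xc' yc'] [xe' ye'] [xmj' ymj']].
have [yjj|yjj] := leqP (y j) (y j').
  pose t := (j `|` c')%O.
  have xt : x t = x j by rewrite xU; nat_lia.
  have yt : y t = y j' by rewrite yU; nat_lia.
  exists (w + U_(enum_rank j) + pair_mnm c' e')%MM; split; last exact: rt_refl.
  apply: (@rt_trans _ _ _ (w + U_(enum_rank c) + pair_mnm t e')%MM).
    by apply: (@reach_rectangle _ _ (w + U_(enum_rank c))%MM e t e' j');
      [mnm_ac|mnm_ac|nat_lia..].
  by apply: (@reach_rectangle _ _ (w + U_(enum_rank e'))%MM c c' j t);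
    [mnm_ac|mnm_ac|nat_lia..].
pose t := (j `&` j')%O.
have xt : x t = x j by rewrite xI; nat_lia.
have yt : y t = y j' by rewrite yI; nat_lia.
exists (w + U_(enum_rank c) + pair_mnm t e')%MM; split.
  by apply: (@reach_rectangle _ _ (w + U_(enum_rank c))%MM e t e' j');
    [mnm_ac|mnm_ac|nat_lia..].
by apply: (@reach_rectangle _ _ (w + U_(enum_rank e'))%MM c' c t j);
  [mnm_ac|mnm_ac|nat_lia..].
Qed.

(** The order dual of [fork_meet]. *)
Lemma fork_join w m c e j m' c' e' :
  rectangle m c e j -> rectangle m' c' e' j ->
  joinable (w + U_(enum_rank m') + pair_mnm c e)%MM
           (w + U_(enum_rank m) + pair_mnm c' e')%MM.
Proof.
have [xI xU yI yU xyinj] := xy.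
wlog : c e m c' e' m' / (x m' <= x m)%N.
  move=> H R R'; have [mm|/ltnW mm] := leqP (x m') (x m); first exact: H.
  exact/joinable_sym/H.
move=> xmm [[xc yc] [xe ye] [xmj ymj]] [[xc' yc'] [xe' ye'] [xmj' ymj']].
have [ymm|ymm] := leqP (y m') (y m).
  pose t := (m `&` e')%O.
  have xt : x t = x m by rewrite xI; nat_lia.
  have yt : y t = y m' by rewrite yI; nat_lia.
  exists (w + U_(enum_rank m) + pair_mnm c' e')%MM; split; last exact: rt_refl.
  apply: (@rt_trans _ _ _ (w + U_(enum_rank e) + pair_mnm c' t)%MM).
    by apply: (@reach_rectangle _ _ (w + U_(enum_rank e))%MM m' c' t c);
      [mnm_ac|mnm_ac|nat_lia..].
  by apply: (@reach_rectangle _ _ (w + U_(enum_rank c'))%MM t m e' e);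
    [mnm_ac|mnm_ac|nat_lia..].
pose t := (m `|` m')%O.
have xt : x t = x m by rewrite xU; nat_lia.
have yt : y t = y m' by rewrite yU; nat_lia.
exists (w + U_(enum_rank e) + pair_mnm c' t)%MM; split.
  by apply: (@reach_rectangle _ _ (w + U_(enum_rank e))%MM m' c' t c);
    [mnm_ac|mnm_ac|nat_lia..].
by apply: (@reach_rectangle _ _ (w + U_(enum_rank c'))%MM m t e e');
  [mnm_ac|mnm_ac|nat_lia..].
Qed.

(** One of the two remaining vertices of the rectangle spanned by two rectangles
    placed diagonally belongs to the lattice. *)
Hypothesis diagonal : forall a b c g h k l,
  rectangle a g h b -> rectangle b k l c ->
  (exists t, x t = x a /\ y t = y c) \/ (exists t, x t = x c /\ y t = y a).

(** Two rectangles placed diagonally, sharing the vertex [b]. If [t] is the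
    upper left vertex of the rectangle from [a] to [c], then both results
    rewrite to the product of [t], [h] and [l]; if it is the lower right one,
    to the product of [t], [g] and [k]. *)
Lemma fork_chain w a b c g h k l :
  rectangle a g h b -> rectangle b k l c ->
  joinable (w + U_(enum_rank c) + pair_mnm g h)%MM
           (w + U_(enum_rank a) + pair_mnm k l)%MM.
Proof.
move=> R R'; have := diagonal R R'.
move: R R' => [[xg yg] [xh yh] [xab yab]] [[xk yk] [xl yl] [xbc ybc]].
case=> -[t [xt yt]].
  exists (w + U_(enum_rank h) + pair_mnm t l)%MM; split.
    by apply: (@reach_rectangle _ _ (w + U_(enum_rank h))%MM g t l c);
      [mnm_ac|mnm_ac|nat_lia..].
  by apply: (@reach_rectangle _ _ (w + U_(enum_rank l))%MM a t h k);
    [mnm_ac|mnm_ac|nat_lia..].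
exists (w + U_(enum_rank g) + pair_mnm k t)%MM; split.
  by apply: (@reach_rectangle _ _ (w + U_(enum_rank g))%MM h k t c);
    [mnm_ac|mnm_ac|nat_lia..].
by apply: (@reach_rectangle _ _ (w + U_(enum_rank k))%MM a g t l);
  [mnm_ac|mnm_ac|nat_lia..].
Qed.

Lemma hibi_step_rectangle u v : hibi_step u v -> exists w m c e j,
  [/\ rectangle m c e j, u = (w + pair_mnm m j)%MM & v = (w + pair_mnm c e)%MM].
Proof.
move=> [w [c [e [ce -> ->]]]]; have [R|R] := incomparable_rectangle ce.
  by exists w, (c `&` e)%O, c, e, (c `|` e)%O.
by exists w, (c `&` e)%O, e, c, (c `|` e)%O; split=> //; rewrite [in RHS]pair_mnmC.
Qed.

Lemma hibi_local_confluence u v v' :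
  hibi_step u v -> hibi_step u v' -> joinable v v'.
Proof.
have [xI xU yI yU xyinj] := xy.
move=> /hibi_step_rectangle[w [m [c [e [j [R uE ->]]]]]].
move=> /hibi_step_rectangle[w' [m' [c' [e' [j' [R' uE' ->]]]]]].
have E z : (w (enum_rank z) + ((m == z) + (j == z)) =
    w' (enum_rank z) + ((m' == z) + (j' == z)))%N.
  by have := congr1 (fun u => u (enum_rank z)) (etrans (esym uE) uE');
    rewrite /= !(mnmDE, mnm1_rankE).
have mj : m != j by apply/eqP => mj; case: (R) => _ _ []; rewrite mj ltnn.
have mj' : m' != j' by apply/eqP => mj'; case: (R') => _ _ []; rewrite mj' ltnn.
have shift w1 w2 a b : (forall z, w1 (enum_rank z) + (a == z) = w2 (enum_rank z) + (b == z))%N ->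
   a != b -> exists w0, w1 = (w0 + U_(enum_rank b))%MM /\ w2 = (w0 + U_(enum_rank a))%MM.
  move=> H ab; have [|w0 w0E] := @mnm_split w1 b.
    by have := H b; rewrite eqxx (negPf ab); nat_lia.
  exists w0; split=> //; apply: mnm_rankP => z; have := H z.
  by rewrite w0E !mnmDE !mnm1_rankE; nat_lia.
have [mm|mm] := eqVneq m m'; have [jj|jj] := eqVneq j j'.
- subst m' j'; have -> : w' = w by apply: mnm_rankP => z; have := E z; nat_lia.
  have [[? ?] [? ?] _] := R; have [[? ?] [? ?] _] := R'.
  have -> : c' = c by apply: xyinj; nat_lia.
  have -> : e' = e by apply: xyinj; nat_lia.
  by exists (w + pair_mnm c e)%MM; split; apply: rt_refl.
- subst m'; have [|w0 [-> ->]] := shift w w' j j' _ jj.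
    by move=> z; have := E z; nat_lia.
  exact: fork_meet R R'.
- subst j'; have [|w0 [-> ->]] := shift w w' m m' _ mm.
    by move=> z; have := E z; nat_lia.
  exact: fork_join R R'.
have [mj1|mj1] := eqVneq m j'.
  subst j'; have jm : j != m'.
    apply/eqP => jm; case: R R' => _ _ [H _] [_ _ [H' _]].
    by move: H; rewrite jm ltnNge (ltnW H').
  have [|w0 [-> ->]] := shift w w' j m' _ jm; first by move=> z; have := E z;
    nat_lia.
  exact/joinable_sym/(fork_chain _ R' R).
have [jm1|jm1] := eqVneq j m'.
  subst m'; have [|w0 [-> ->]] := shift w w' m j' _ mj1; first by move=> z;
    have := E z; nat_lia.
  exact: (fork_chain _ R R').
(* two steps on disjoint factors of the monomial commute *)
have [|w1 w1E] := @mnm_split w m'.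
  by have := E m'; rewrite eqxx (negPf mm) (negPf jm1); nat_lia.
have [|w0 w0E] := @mnm_split w1 j'.
  have := E j'; rewrite eqxx (negPf mj1) (negPf jj) (negPf mj') w1E mnmDE mnm1E.
  by rewrite (inj_eq enum_rank_inj) (negPf mj'); nat_lia.
have wE : w = (w0 + pair_mnm m' j')%MM by rewrite w1E w0E; mnm_ac.
have w'E : w' = (w0 + pair_mnm m j)%MM.
  by apply: mnm_rankP => z; have := E z; rewrite wE !(mnmDE, mnm1_rankE); nat_lia.
exists (w0 + pair_mnm c e + pair_mnm c' e')%MM.
rewrite wE w'E; case: R R' => [[? ?] [? ?] [? ?]] [[? ?] [? ?] [? ?]]; split.
  by apply: (@reach_rectangle _ _ (w0 + pair_mnm c e)%MM m' c' e' j');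
    [mnm_ac|mnm_ac|nat_lia..].
by apply: (@reach_rectangle _ _ (w0 + pair_mnm c' e')%MM m c e j);
  [mnm_ac|mnm_ac|nat_lia..].
Qed.

(** The termination measure: each variable counts for the area of the rectangle
    that its element spans with the origin. *)
Definition area u : nat := (\sum_a u (enum_rank a) * (x a * y a))%N.

Lemma hibi_step_area u v : hibi_step u v -> (area v < area u)%N.
Proof.
move=> /hibi_step_rectangle[w [m [c [e [j [R -> ->]]]]]].
have areaD u' v' : area (u' + v')%MM = (area u' + area v')%N.
  by rewrite /area -big_split; apply: eq_bigr => a _; rewrite mnmDE mulnDl.
have area1 a : area U_(enum_rank a)%MM = (x a * y a)%N.
  rewrite /area (bigD1 a) //= mnm1E eqxx mul1n big1 ?addn0 // => b ba.
  by rewrite mnm1E (inj_eq enum_rank_inj) eq_sym (negPf ba).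
rewrite !areaD !area1 ltn_add2l.
by case: R => [[-> ->] [-> ->] [? ?]]; nia.
Qed.

Lemma hibi_equiv_joinable u v : hibi_equiv u v -> joinable u v.
Proof. exact: (church_rosser hibi_step_area hibi_local_confluence). Qed.

End Planar.

(** * The Gröbner basis of a planar lattice *)

Section PlanarBasis.

Variables (K : fieldType) (d : Order.disp_t) (L : finTBDistrLatticeType d).
Variables (vle : rel L) (x y : L -> nat).
Hypothesis vle_rank : rank_order vle.
Hypothesis xy : planar_coordinates x y.
Hypothesis diagonal : forall a b c g h k l,
  rectangle x y a g h b -> rectangle x y b k l c ->
  (exists t, x t = x a /\ y t = y c) \/ (exists t, x t = x c /\ y t = y a).

Implicit Types a b c e : L.
Implicit Types u v w : 'X_{1..#|L|}.
Implicit Types f g h : {mpoly K[#|L|]}.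

Lemma reach_lex_lt u v : clos_refl_trans _ (@hibi_step d L) u v ->
  u = v \/ lex_lt vle v u.
Proof.
elim=> {u v} [u v /(lex_lt_step vle_rank)|u|u v w _ uv _ vw]; [by right|by left|].
case: uv vw => [<-//|vu] [<-|wv]; right=> //.
exact: lex_lt_trans vle_rank _ _ _ wv vu.
Qed.

(** A monomial not divisible by the initial monomial of any Hibi relation is in
    normal form. By confluence every monomial of its class rewrites to it, so it
    is the smallest of the class. It is not initial for an element of the ideal,
    because such an element has a second monomial in that class. *)
Lemma planar_initial_monomial f u : hibi_ideal L K f ->
  initial_monomial (lex_lt vle) f u ->
  exists c e, (c >< e)%O /\ (pair_mnm (c `&` e)%O (c `|` e)%O <= u)%MM.
Proof.
move=> If [uf fu]; apply: NNPP => nf.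
have [v [vf vu uv]] := hibi_ideal_support If uf.
have [t [ut vt]] := hibi_equiv_joinable xy diagonal uv.
have tu : t = u.
  move/clos_rt_rt1n_iff: ut => [//|s r us _]; case: nf.
  by have [w [c [e [ce -> _]]]] := us; exists c, e; split=> //; apply: lem_addl.
rewrite tu in vt; case: (reach_lex_lt vt) => [E|uv']; first by rewrite E eqxx in vu.
by have := lex_lt_trans vle_rank uv' (fu v vf vu); rewrite lex_lt_irr.
Qed.

Definition hibi_seq : seq {mpoly K[#|L|]} :=
  [seq - hibi_binomial K p.1 p.2 | p <- enum {: L * L} & (p.1 >< p.2)%O].

Lemma hibi_seqP f : reflect (exists a b, (a >< b)%O /\ f = - hibi_binomial K a b)
  (f \in hibi_seq).
Proof.
apply: (iffP mapP) => [[[a b]]|[a [b [ab ->]]]].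
  by rewrite mem_filter /= => /andP[ab _] ->; exists a, b.
by exists (a, b); rewrite // mem_filter /= ab mem_enum.
Qed.

Lemma msupp_hibi_seq c e : (c >< e)%O -> msupp (- hibi_binomial K c e) =i
  [:: pair_mnm c e; pair_mnm (c `&` e)%O (c `|` e)%O].
Proof.
move=> ce v; rewrite (perm_mem (msuppN _)) hibi_binomialE.
exact/msupp_binomial/pair_mnm_complement.
Qed.

Lemma initial_hibi_seq c e : (c >< e)%O -> initial_monomial (lex_lt vle)
  (- hibi_binomial K c e) (pair_mnm (c `&` e)%O (c `|` e)%O).
Proof. by move=> ce; apply/initial_monomialN/initial_hibi. Qed.

Lemma hibi_seq_groebner : groebner_basis (lex_lt vle) hibi_seq (hibi_ideal L K).
Proof.
have GI g : g \in hibi_seq -> hibi_ideal L K g.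
  move=> /hibi_seqP[a [b [_ ->]]]; apply/ideal_genN/ideal_gen_mem.
  by exists a, b.
split=> // [g /hibi_seqP[a [b [ab ->]]]|f].
  apply/eqP => g0; have := msupp_hibi_seq ab (pair_mnm a b).
  by rewrite g0 mem_head msupp0.
split; first by apply: ideal_gen_sub => p [g [u [/GI Ig gu ->]]]; exists g, u.
apply: ideal_gen_trans => p [g [u [Ig gu ->]]].
have [c [e [ce /submK <-]]] := planar_initial_monomial Ig gu.
rewrite mpolyXD; apply/ideal_genM/ideal_gen_mem.
exists (- hibi_binomial K c e), (pair_mnm (c `&` e)%O (c `|` e)%O).
by split; [apply/hibi_seqP; exists c, e | apply: initial_hibi_seq|].
Qed.

Lemma hibi_seq_reduced :
  reduced_groebner_basis (lex_lt vle) hibi_seq (hibi_ideal L K).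
Proof.
have initE c e u : (c >< e)%O ->
    initial_monomial (lex_lt vle) (- hibi_binomial K c e) u ->
    u = pair_mnm (c `&` e)%O (c `|` e)%O.
  move=> ce ui; apply: (initial_monomial_unique vle_rank ui).
  exact: initial_hibi_seq.
split; first exact: hibi_seq_groebner.
  move=> _ u /hibi_seqP[c [e [ce ->]]] /(initE _ _ _ ce)->.
  rewrite hibi_binomialE opprB mcoeffB !mcoeffX eqxx.
  by rewrite (negPf (pair_mnm_complement ce)) subr0.
move=> _ _ u v /hibi_seqP[c [e [ce ->]]] /hibi_seqP[c' [e' [ce' ->]]] gh.
move=> /(initE _ _ _ ce)-> vh; apply: contra gh => uv.
have {uv} vE : v = pair_mnm (c `&` e)%O (c `|` e)%O.
  have v2 : mdeg v = 2%N.
    by move: vh; rewrite msupp_hibi_seq // !inE => /orP[]/eqP->;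
      rewrite mdeg_pair_mnm.
  have := mdegD (v - pair_mnm (c `&` e)%O (c `|` e)%O)%MM (pair_mnm (c `&` e)%O (c `|` e)%O).
  rewrite submK // v2 mdeg_pair_mnm => /esym/(@addIn 2 _ 0%N)/eqP.
  by rewrite mdeg_eq0 => /eqP v0; rewrite -(submK uv) v0 add0m.
have lt c1 e1 : (c1 >< e1)%O -> (c1 `&` e1 < c1 `|` e1)%O.
  by move=> /incomparableP[l1 _ l3 _]; apply: lt_trans l1 l3.
move: vh; rewrite vE msupp_hibi_seq // !inE => /orP[]/eqP/pair_mnm_inj E.
  case/negP: ce'; have := ltW (lt _ _ ce); rewrite /Order.comparable.
  by case: E => -[-> ->] ->; rewrite ?orbT.
case: E => -[mE jE]; last first.
  by have := lt _ _ ce; rewrite mE jE => /(lt_trans (lt _ _ ce')); rewrite ltxx.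
have /conditionally_URCP urc := planar_URC xy.
have [] := set2_inj (urc _ _ _ _ ce ce' mE jE) => -[-> ->] //.
by rewrite !hibi_binomialE pair_mnmC meetC joinC.
Qed.

Lemma hibi_seq_relations :
  same_up_to_sign (fun g => g \in hibi_seq) (hibi_relation L K).
Proof.
split=> f [] => [/hibi_seqP[a [b [ab ->]]]|a [b [ab ->]]].
  by right; exists a, b; rewrite opprK.
by right; apply/hibi_seqP; exists a, b.
Qed.

End PlanarBasis.

(** * Corners of a planar region *)

Section Corners.

(* Linear arithmetic on the indices; the membership hypotheses would only
   multiply the Boolean cases. *)
Ltac index_lia := repeat match goal with
  | H : is_true (?f _ _) |- _ => is_var f; clear H
  | H : is_true (negb (?f _ _)) |- _ => is_var f; clear H
  end; lia.

Implicit Types P : nat -> nat -> bool.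

Definition region_closed P : Prop := forall i j i' j', P i j -> P i' j' ->
  P (minn i i') (minn j j') /\ P (maxn i i') (maxn j j').

(** The four given points are the free vertices of two rectangles placed
    diagonally, from (i0, j0) to (i1, j1) and from (i1, j1) to (i2, j2). *)
Definition diagonal_closed P : Prop := forall i0 i1 i2 j0 j1 j2,
  (i0 < i1)%N -> (i1 < i2)%N -> (j0 < j1)%N -> (j1 < j2)%N ->
  P i0 j1 -> P i1 j0 -> P i1 j2 -> P i2 j1 -> P i0 j2 \/ P i2 j0.

Definition interior P i j : bool :=
  [&& P i j, (0 < i)%N, (0 < j)%N &
   [&& P i.-1 j, P i.+1 j, P i j.+1 & P i j.-1]].

Definition strictly_comparable (i j i' j' : nat) : bool :=
  (i < i')%N && (j < j')%N || (i' < i)%N && (j' < j)%N.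

(** Every corner missing its upper left neighbour is comparable, in a strong
    sense, to every corner missing its lower right neighbour; in particular
    no corner is critical. *)
Definition opposite_corners_comparable P : Prop := forall i j i' j',
  interior P i j -> ~~ P i.-1 j.+1 -> interior P i' j' -> ~~ P i'.+1 j'.-1 ->
  strictly_comparable i j i' j'.

Lemma closed_min P i j i' j' k l : region_closed P -> P i j -> P i' j' ->
  k = minn i i' -> l = minn j j' -> P k l.
Proof. by move=> cl p q -> ->; case: (cl _ _ _ _ p q). Qed.

Lemma closed_max P i j i' j' k l : region_closed P -> P i j -> P i' j' ->
  k = maxn i i' -> l = maxn j j' -> P k l.
Proof. by move=> cl p q -> ->; case: (cl _ _ _ _ p q). Qed.

Lemma region_closedT P : region_closed P -> region_closed (fun i j => P j i).
Proof. by move=> cl i j i' j' p q; apply: cl. Qed.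

Lemma interiorT P i j : interior P i j -> interior (fun i j => P j i) j i.
Proof.
move=> /and4P[p i0 j0 /and4P[p1 p2 p3 p4]].
by rewrite /interior p i0 j0 p1 p2 p3 p4.
Qed.

(** Two corners of the same kind in a wrong position fill in the missing
    neighbour of one of them by meets and joins. *)
Lemma upper_corners_comparable P i j i' j' : region_closed P ->
  interior P i j -> ~~ P i.-1 j.+1 -> interior P i' j' -> ~~ P i'.-1 j'.+1 ->
  (i, j) != (i', j') -> strictly_comparable i j i' j'.
Proof.
move=> cl; wlog : i j i' j' / (i < i')%N || (i == i') && (j <= j')%N.
  move=> H; have [|nlt] := boolP ((i < i')%N || (i == i') && (j <= j')%N);
    first exact: H.
  move=> c nc c' nc' ne; rewrite /strictly_comparable orbC.
  apply: H => //; last by rewrite eq_sym.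
  by move: nlt; index_lia.
move=> ii c nc c' nc' ne; apply: contraNT nc => ncmp.
move: c c' => /and4P[_ i0 j0 /and4P[p1 p2 p3 p4]] /and4P[_ i0' j0' /and4P[q1 q2 q3 q4]].
case/orP: ii => [ii|/andP[/eqP ii jj]].
  have jj : (j' <= j)%N by move: ncmp; rewrite /strictly_comparable; index_lia.
  case/negP: nc'.
  have r : P i'.-1 j.+1 by apply: (closed_max cl q1 p3); index_lia.
  by apply: (closed_min cl r q3); index_lia.
have lt : (j < j')%N.
  by rewrite ltn_neqAle jj andbT; apply: contra ne => /eqP->; rewrite ii.
by apply: (closed_min cl q1 p3); index_lia.
Qed.

(** Corners of opposite kind facing each other across the region give two
    rectangles placed diagonally, both remaining vertices of which are missing;
    in the other wrong positions meets and joins fill in a missing neighbour. *)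
Lemma diagonal_corners_comparable P : region_closed P -> diagonal_closed P ->
  opposite_corners_comparable P.
Proof.
move=> cl diag i j i' j' /and4P[p i0 j0 /and4P[p1 p2 p3 p4]] nc.
move=> /and4P[q i0' j0' /and4P[q1 q2 q3 q4]] nc'; apply: contraT => ncmp.
have [/andP[ii jj]|nii] := boolP ((i <= i')%N && (j' <= j)%N).
  have r1 : P i.-1 j' by apply: (closed_min cl p1 q); index_lia.
  have r2 : P i j'.-1 by apply: (closed_min cl p q4); index_lia.
  have [||||r|r] := diag i.-1 i i'.+1 j'.-1 j' j.+1 _ _ _ _ r1 r2 p3 q2;
    try index_lia.
    by rewrite r in nc.
  by rewrite r in nc'.
have {ncmp} ncmp : (i' <= i)%N && (j <= j')%N.
  by move: ncmp nii; rewrite /strictly_comparable; index_lia.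
have [jj|jj] := ltnP j j'.
  case/negP: nc; have [ii|ii] := ltnP i' i.
    have r : P i.-1 j' by apply: (closed_max cl q p1); index_lia.
    by apply: (closed_min cl r p3); index_lia.
  by apply: (closed_min cl q1 p3); index_lia.
case/negP: nc'; apply: (closed_min cl q2 p4); index_lia.
Qed.

Lemma bool_jump (p : pred nat) k l : (k <= l)%N -> p k -> ~~ p l ->
  exists n, [/\ (k <= n < l)%N, p n & ~~ p n.+1].
Proof.
elim: l => [|l IH]; first by rewrite leqn0 => /eqP-> ->.
rewrite leq_eqVlt => /orP[/eqP-> -> //|kl pk npl].
have [pl|npl'] := boolP (p l); first by exists l; rewrite -ltnS kl ltnSn.
by have [n [/andP[kn nl] pn npn]] := IH kl pk npl'; exists n; rewrite kn ltnW.
Qed.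

Definition columns_convex P : Prop := forall i j j' j'',
  P i j -> P i j'' -> (j <= j' <= j'')%N -> P i j'.

(** Moving up the column [i0] from [j1] to [j2] one leaves the region, and from
    there one comes back to it on the way right to the column [i1]: the turning
    point is a corner. *)
Lemma upper_corner_exists P i0 i1 i2 j0 j1 j2 : region_closed P ->
  columns_convex P -> columns_convex (fun i j => P j i) ->
  (i0 < i1)%N -> (i1 < i2)%N -> (j0 < j1)%N -> (j1 < j2)%N ->
  P i0 j1 -> P i1 j0 -> P i1 j2 -> P i2 j1 -> ~~ P i0 j2 ->
  exists i j, [/\ interior P i j, ~~ P i.-1 j.+1, (i0 < i <= i1)%N & (j1 <= j < j2)%N].
Proof.
move=> cl cv rv i01 i12 j01 j12 p01 p10 p12 p21 np.
have p11 : P i1 j1 by apply: (closed_max cl p01 p10); index_lia.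
have p00 : P i0 j0 by apply: (closed_min cl p01 p10); index_lia.
have [j [jj pj npj]] := bool_jump (ltnW j12) p01 np.
have p1j : P i1 j.+1 by apply: (cv _ _ _ _ p11 p12); index_lia.
have [|k [kk npk]] := @bool_jump (fun k => ~~ P k j.+1) _ _ (ltnW i01) npj.
  by rewrite negbK.
rewrite negbK => pk.
have p2j : P i2 j by apply: (closed_max cl pj p21); index_lia.
have row i : (i0 <= i <= i2)%N -> P i j by apply: (rv _ _ _ _ pj p2j).
exists k.+1, j; split; try index_lia; last exact: npk.
apply/and4P; split; [apply: row; index_lia | index_lia | index_lia |].
apply/and4P; split; [apply: row; index_lia | apply: row; index_lia | exact: pk |].
have pk0 : P k.+1 j0 by apply: (rv _ _ _ _ p00 p10); index_lia.
have pkj : P k.+1 j by apply: row; index_lia.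
by apply: (cv _ _ _ _ pk0 pkj); index_lia.
Qed.

(** If both remaining vertices were missing, there would be an upper corner
    weakly to the upper left and a lower corner weakly to the lower right of
    the middle point (i1, j1), and these are not strictly comparable. *)
Lemma corners_comparable_diagonal P : region_closed P ->
  columns_convex P -> columns_convex (fun i j => P j i) ->
  opposite_corners_comparable P -> diagonal_closed P.
Proof.
move=> cl cv rv opp i0 i1 i2 j0 j1 j2 i01 i12 j01 j12 p01 p10 p12 p21.
have [|np] := boolP (P i0 j2); [by left | right; apply: contraT => np'].
have [i [j [c nc ii jj]]] :=
  upper_corner_exists cl cv rv i01 i12 j01 j12 p01 p10 p12 p21 np.
have [j' [i' [c' nc' jj' ii']]] :=
  upper_corner_exists (region_closedT cl) rv cv j01 j12 i01 i12 p10 p01 p21 p12 np'.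
have := opp _ _ _ _ c nc (interiorT c') nc'.
by rewrite /strictly_comparable; index_lia.
Qed.

End Corners.

(** * Chain ladders *)

(** A chain of maximal length has [k + l] steps, each increasing [f + g] by
    one, so no value is skipped: if the value [j] of [g] were, then decreasing
    by one the larger values of [g] would leave only [k + l] values of
    [f + g] for the elements of the chain. *)
Lemma full_chain_surjective (T : finType) (C : {set T}) (f g : T -> nat) k l j :
  #|C| = (k + l).+1 -> (forall p, f p <= k)%N -> (forall p, g p <= l)%N ->
  (forall p q, p \in C -> q \in C ->
    (f p <= f q)%N && (g p <= g q)%N || (f q <= f p)%N && (g q <= g p)%N) ->
  (forall p q, f p = f q -> g p = g q -> p = q) ->
  (j <= l)%N -> exists2 p, p \in C & g p = j.
Proof.
move=> Ckl fk gl Cch fg jl.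
have [/existsP[p /andP[pC /eqP gp]]|nj] := boolP [exists p, (p \in C) && (g p == j)].
  by exists p.
have {}nj p : p \in C -> g p != j.
  by move=> pC; apply: contra nj => gp; apply/existsP; exists p; rewrite pC.
pose phi p := (f p + (g p - (j < g p)))%N.
suff : (#|C| <= k + l)%N by rewrite Ckl ltnn.
rewrite cardE -(size_map phi) -(size_iota 0 (k + l)); apply: uniq_leq_size.
  rewrite map_inj_in_uniq ?enum_uniq // => p q; rewrite !mem_enum => pC qC.
  rewrite /phi => E; have := Cch p q pC qC; have := nj p pC; have := nj q qC.
  by move=> gq gp H; apply: fg; lia.
move=> z /mapP[p]; rewrite mem_enum => pC ->; rewrite mem_iota /phi.
by have := nj p pC; have := fk p; have := gl p; lia.
Qed.

Lemma ord_meetE k (i j : 'I_k.+1) : (i `&` j)%O = minn i j :> nat.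
Proof.
by case: (leP i j); [rewrite leEord => /minn_idPl | rewrite ltEord => /ltnW/minn_idPr].
Qed.

Lemma ord_joinE k (i j : 'I_k.+1) : (i `|` j)%O = maxn i j :> nat.
Proof.
by case: (leP i j); [rewrite leEord => /maxn_idPr | rewrite ltEord => /ltnW/maxn_idPl].
Qed.

Section ChainLadder.

Variables (m n : nat) (S : {set grid m n}).

Lemma at_posP i j :
  reflect (exists p, [/\ p \in S, p.1 = i :> nat & p.2 = j :> nat]) (at_pos S i j).
Proof.
apply: (iffP existsP) => [[p /and3P[pS /eqP pi /eqP pj]]|[p [pS <- <-]]];
  exists p => //.
by rewrite pS !eqxx.
Qed.

Lemma grid_inj (p q : grid m n) : p.1 = q.1 :> nat -> p.2 = q.2 :> nat -> p = q.
Proof. by case: p q => [p1 p2] [q1 q2] /= /val_inj-> /val_inj->. Qed.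

Lemma at_pos_coordinates (p : grid m n) : at_pos S p.1 p.2 = (p \in S).
Proof.
apply/at_posP/idP => [[q [qS q1 q2]]|pS]; last by exists p.
by rewrite -(grid_inj q1 q2).
Qed.

Lemma has_neighboursE (p : grid m n) :
  has_neighbours S p = interior (at_pos S) p.1 p.2.
Proof. by rewrite /interior at_pos_coordinates. Qed.

Lemma grid_meetE (p q : grid m n) :
  (p `&` q)%O.1 = minn p.1 q.1 :> nat /\ (p `&` q)%O.2 = minn p.2 q.2 :> nat.
Proof. by rewrite Order.ProdOrder.meetEprod; split; apply: ord_meetE. Qed.

Lemma grid_joinE (p q : grid m n) :
  (p `|` q)%O.1 = maxn p.1 q.1 :> nat /\ (p `|` q)%O.2 = maxn p.2 q.2 :> nat.
Proof. by rewrite Order.ProdOrder.joinEprod; split; apply: ord_joinE. Qed.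

Lemma grid_leE (p q : grid m n) : (p <= q)%O = (p.1 <= q.1)%N && (p.2 <= q.2)%N.
Proof. by rewrite Order.ProdOrder.leEprod !leEord. Qed.

Section Full.

Hypothesis Sfull : full_sublattice S.

Lemma full_closed : region_closed (at_pos S).
Proof.
move=> i j i' j' /at_posP[p [pS <- <-]] /at_posP[q [qS <- <-]].
have [Scl _] := Sfull; have [pqI pqU] := Scl _ _ pS qS.
have [<- <-] := grid_meetE p q; have [<- <-] := grid_joinE p q.
by rewrite !at_pos_coordinates.
Qed.

Lemma full_surjective i j : (i <= m)%N -> (j <= n)%N ->
  (exists j', at_pos S i j') /\ (exists i', at_pos S i' j).
Proof.
move=> im jn; have [_ [C [CS Cch Cmn]]] := Sfull.
have leP (p q : grid m n) : p \in C -> q \in C ->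
    (p.1 <= q.1)%N && (p.2 <= q.2)%N || (q.1 <= p.1)%N && (q.2 <= p.2)%N.
  move=> pC qC; rewrite -!grid_leE.
  by move/forall_inP: Cch => /(_ _ pC)/forall_inP/(_ _ qC).
have ord_le k (i' : 'I_k.+1) : (i' <= k)%N by rewrite -ltnS.
split.
  have [||||||p pC <-] := @full_chain_surjective _ C (fun p => p.2) (fun p => p.1) n m i => //.
  - by rewrite addnC.
  - by move=> p q pC qC; rewrite andbC [X in _ || X]andbC; apply: leP.
  - by move=> p q p2 p1; apply: grid_inj.
  by exists p.2; rewrite at_pos_coordinates (subsetP CS).
have [||||||p pC <-] := @full_chain_surjective _ C (fun p => p.1) (fun p => p.2) m n j => //.
  exact: grid_inj.
by exists p.1; rewrite at_pos_coordinates (subsetP CS).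
Qed.

Lemma at_pos_bound i j : at_pos S i j -> (i <= m)%N /\ (j <= n)%N.
Proof. by move=> /at_posP[p [_ <- <-]]; split; rewrite -ltnS. Qed.

(** The row [j'] contains a point of the sublattice; its meet with the upper
    point or its join with the lower one lies in the column [i]. *)
Lemma full_columns_convex : columns_convex (at_pos S).
Proof.
move=> i j j' j'' p p'' /andP[jj jj'].
have [im jn] := at_pos_bound p''.
have [_ [i' p']] := full_surjective im (leq_trans jj' jn).
have [ii|ii] := leqP i i'; first by apply: (closed_min full_closed p' p''); lia.
by apply: (closed_max full_closed p' p); lia.
Qed.

Lemma full_rows_convex : columns_convex (fun i j => at_pos S j i).
Proof.
move=> i j j' j'' p p'' /andP[jj jj'].
have [im jn] := at_pos_bound p''.
have [[i' p'] _] := full_surjective (leq_trans jj' im) jn.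
have [ii|ii] := leqP i i'; first by apply: (closed_min full_closed p' p''); lia.
by apply: (closed_max full_closed p' p); lia.
Qed.

End Full.

(** Without critical corners, a corner missing its upper left neighbour and one
    missing its lower right neighbour are an upper and a lower corner. They are
    distinct, comparable, and differ in both coordinates. *)
Lemma chain_ladder_diagonal : chain_ladder S ->
  (forall p, ~~ critical_corner S p) -> diagonal_closed (at_pos S).
Proof.
move=> [Sfull [C [_ Cch CC]] Sc] ncrit.
apply: (corners_comparable_diagonal (full_closed Sfull) (full_columns_convex Sfull)
  (full_rows_convex Sfull)).
move=> i j i' j' c nc c' nc'.
have [/at_posP[p [pS pi pj]] _ _ _] := and4P c.
have [/at_posP[q [qS qi qj]] _ _ _] := and4P c'; subst i j i' j'.
rewrite -!has_neighboursE in c c'.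
have pup : upper_corner S p.
  rewrite /upper_corner c nc /=; have := ncrit p.
  by rewrite /critical_corner c nc /= negbK.
have qlo : lower_corner S q.
  rewrite /lower_corner c' nc' andbT /=; have := ncrit q.
  by rewrite /critical_corner c' nc' andbT /= negbK.
have pq : p != q.
  by apply/eqP => pq; move: qlo nc; rewrite -pq => /and3P[_ ->].
have [] := Sc p q; rewrite /corner ?pup ?qlo ?orbT // => /eqP n1 /eqP n2.
have {}n1 : p.1 <> q.1 :> nat by move=> /val_inj.
have {}n2 : p.2 <> q.2 :> nat by move=> /val_inj.
have pC : p \in C by rewrite CC ?pup.
have qC : q \in C by rewrite CC ?qlo ?orbT.
move/forall_inP: Cch => /(_ _ pC)/forall_inP/(_ _ qC).
rewrite /Order.comparable !grid_leE /strictly_comparable.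
move: n1 n2 => /eqP n1 /eqP n2.
by rewrite !ltn_neqAle n1 n2 eq_sym n1 eq_sym n2.
Qed.

Lemma diagonal_chain_ladder : full_sublattice S -> diagonal_closed (at_pos S) ->
  chain_ladder S /\ forall p, ~~ critical_corner S p.
Proof.
move=> Sfull diag; have Scl := full_closed Sfull.
have opp := diagonal_corners_comparable Scl diag.
have ncrit p : ~~ critical_corner S p.
  apply/negP => /and3P[]; rewrite has_neighboursE => c nc nc'.
  by have := opp _ _ _ _ c nc c nc'; rewrite /strictly_comparable; lia.
have cmp p q : corner S p -> corner S q -> p != q ->
    strictly_comparable p.1 p.2 q.1 q.2.
  have cP r : corner S r -> interior (at_pos S) r.1 r.2 /\
      (~~ at_pos S r.1.-1 r.2.+1 \/ ~~ at_pos S r.1.+1 r.2.-1).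
    rewrite /corner /upper_corner /lower_corner /critical_corner -has_neighboursE.
    by case/or3P => /and3P[? ? ?]; split=> //; [left|right|left].
  move=> /cP[c nc] /cP[c' nc'] pq.
  have ne : (p.1 : nat, p.2 : nat) != (q.1 : nat, q.2 : nat).
    by apply: contraNneq pq => -[? ?]; apply/eqP/grid_inj.
  have scC i j i' j' : strictly_comparable i j i' j' = strictly_comparable i' j' i j.
    exact: orbC.
  case: nc nc' => [nc|nc] [nc'|nc'].
  - exact: upper_corners_comparable Scl c nc c' nc' ne.
  - exact: opp c nc c' nc'.
  - by rewrite scC; apply: opp c' nc' c nc.
  have neT : (p.2 : nat, p.1 : nat) != (q.2 : nat, q.1 : nat).
    by apply: contraNneq ne => -[-> ->].
  have := upper_corners_comparable (region_closedT Scl) (interiorT c) nc (interiorT c') nc' neT.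
  by rewrite /strictly_comparable ![(p.2 < _)%N && _]andbC ![(q.2 < _)%N && _]andbC.
split=> //; split=> //.
  exists [set p in S | upper_corner S p || lower_corner S p]; split.
  - by apply/subsetP => p; rewrite inE => /andP[].
  - apply/forall_inP => p; rewrite inE => /andP[_ pc].
    apply/forall_inP => q; rewrite inE => /andP[_ qc].
    have [->|pq] := eqVneq p q; first by rewrite /Order.comparable lexx.
    have := cmp p q _ _ pq; rewrite /corner !orbA pc qc => /(_ isT isT).
    rewrite /Order.comparable !grid_leE /strictly_comparable.
    by case/orP => /andP[/ltnW-> /ltnW->]; rewrite ?orbT.
  - move=> p pc; rewrite inE pc andbT.
    by case/orP: pc => /and3P[/and4P[]].
move=> p q pc qc pq; have := cmp p q pc qc pq; rewrite /strictly_comparable => H.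
by split; apply/eqP => E; move: H; rewrite E !ltnn ?andbF.
Qed.

End ChainLadder.

(** * Two chains covering a poset of width two *)

Section WidthTwo.

Variables (disp : Order.disp_t) (T : finPOrderType disp).
Implicit Types (A C D P : {set T}) (a b p q z : T).

Lemma maximal_exists A p : p \in A ->
  exists2 z, z \in A & forall q, q \in A -> ~~ (z < q)%O.
Proof.
move=> pA; case: (arg_maxnP (fun q => #|[set r | (r <= q)%O]|) pA) => z zA zmax.
exists z => // q /zmax; apply: contraL => zq; rewrite -ltnNge.
apply: proper_card; apply/properP; split.
  by apply/subsetP => r; rewrite !inE => rz; apply: le_trans rz (ltW zq).
by exists q; rewrite !inE ?lexx // (lt_geF zq).
Qed.

Lemma is_chainP C :
  reflect (forall a b, a \in C -> b \in C -> (a >=< b)%O) (is_chain C).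
Proof.
apply: (iffP forall_inP) => [H a b aC bC|H a aC].
  by move/forall_inP: (H a aC); apply.
by apply/forall_inP => b bC; apply: H.
Qed.

(** Galvin's induction: [x] is the largest element of the chain [C] lying in a
    two-element antichain of [P] without [a]. Removing from [P] the chain made
    of [a] and the elements of [C] below [x] leaves a chain. *)
Lemma width_two_step P C D a x : is_chain C -> is_chain D -> P = a |: (C :|: D) ->
  (x < a)%O -> x \in C ->
  (forall z w, z \in C -> w \in D -> (z >< w)%O -> (z <= x)%O) ->
  exists C' D', [/\ C' :|: D' = P, [disjoint C' & D'], is_chain C' & is_chain D'].
Proof.
move=> /is_chainP Cch /is_chainP Dch PE xa xC xmax.
pose K := a |: [set z in C | (z <= x)%O].
have KP : K \subset P.
  rewrite PE setUS //; apply/subsetP => z; rewrite !inE => /andP[-> _] //.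
have Klt z : z \in C -> (z <= x)%O -> (z <= a)%O.
  by move=> _ zx; apply: le_trans zx (ltW xa).
exists K, (P :\: K); split.
- by rewrite -{1}(setIidPr KP) setID.
- by rewrite -setI_eq0 setIDA setDIl setDv set0I.
- apply/is_chainP => z w; rewrite !inE /Order.comparable.
  move=> /orP[/eqP->|/andP[zC zx]] /orP[/eqP->|/andP[wC wx]].
  + by rewrite lexx.
  + by rewrite (Klt w) ?orbT.
  + by rewrite (Klt z).
  + exact: Cch.
have PK z : z \in P :\: K -> z \in C /\ ~~ (z <= x)%O \/ z \in D.
  rewrite PE !inE negb_or negb_and => /andP[/andP[/negPf-> nz]] /= /orP[zC|];
    last by right.
  by rewrite zC in nz; left.
apply/is_chainP => z w /PK[[zC nz]|zD] /PK[[wC nw]|wD].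
- exact: Cch.
- by apply: contraR nz; apply: xmax.
- by rewrite comparable_sym; apply: contraR nw; apply: xmax.
- exact: Dch.
Qed.

Lemma width_two_chains P :
  (forall p q r, p \in P -> q \in P -> r \in P ->
    (p >< q)%O -> (p >< r)%O -> (q >< r)%O -> False) ->
  exists C D, [/\ C :|: D = P, [disjoint C & D], is_chain C & is_chain D].
Proof.
have [k] := ubnP #|P|; elim: k P => // k IH P; rewrite ltnS => Pk w2.
have [->|[p0 /maximal_exists[a aP amax]]] := set_0Vmem P.
  exists set0, set0; rewrite setU0 -setI_eq0 set0I; split=> //.
    by apply/is_chainP => a b; rewrite inE.
  by apply/is_chainP => a b; rewrite inE.
have [||C [D [CDP CD Cch Dch]]] := IH (P :\ a).
- by move: Pk; rewrite (cardsD1 a P) aP.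
- by move=> p q r /setD1P[_ pP] /setD1P[_ qP] /setD1P[_ rP]; apply: w2.
have PE : P = a |: (C :|: D) by rewrite CDP setD1K.
pose XC := [set z in C | [exists w in D, (z >< w)%O]].
pose XD := [set w in D | [exists z in C, (z >< w)%O]].
have [XC0|[x0 x0C]] := set_0Vmem XC.
  have cmp z w : z \in C -> w \in D -> (z >=< w)%O.
    move=> zC wD; apply/negPn/negP => zw.
    have : z \in XC by rewrite inE zC; apply/exists_inP; exists w.
    by rewrite XC0 inE.
  exists [set a], (C :|: D); rewrite -PE; split=> //.
  - by rewrite disjoints1 CDP !inE eqxx.
  - by apply/is_chainP => z w; rewrite !inE => /eqP-> /eqP->; apply: comparablexx.
  - move/is_chainP: Cch => Cch; move/is_chainP: Dch => Dch.
    apply/is_chainP => z w; rewrite !inE => /orP[zC|zD] /orP[wC|wD];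
      by [apply: Cch | apply: cmp | rewrite comparable_sym;
        apply: cmp | apply: Dch].
have [y0 y0D] : exists y0, y0 \in XD.
  move: x0C; rewrite inE => /andP[x0C /exists_inP[y0 y0D x0y0]].
  by exists y0; rewrite inE y0D; apply/exists_inP; exists x0.
have [x xX xmax] := maximal_exists x0C; have [y yX ymax] := maximal_exists y0D.
move: (xX) (yX); rewrite !inE => /andP[xC /exists_inP[w wD xw]].
move=> /andP[yD /exists_inP[z zC zy]].
have chain_le E (m v : T) : is_chain E -> m \in E -> v \in E -> ~~ (m < v)%O -> (v <= m)%O.
  move=> /is_chainP Ech mE vE; rewrite lt_neqAle; have := Ech m v mE vE.
  by rewrite /Order.comparable; case: eqP => [->|_] //= /orP[->|].
have xle z' w' : z' \in C -> w' \in D -> (z' >< w')%O -> (z' <= x)%O.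
  move=> z'C w'D z'w'; apply: (chain_le C) => //; apply: xmax.
  by rewrite inE z'C; apply/exists_inP; exists w'.
have yle z' w' : z' \in C -> w' \in D -> (z' >< w')%O -> (w' <= y)%O.
  move=> z'C w'D z'w'; apply: (chain_le D) => //; apply: ymax.
  by rewrite inE w'D; apply/exists_inP; exists z'.
have xy : (x >< y)%O.
  apply/negP => /orP[le|le].
    case/negP: (zy); rewrite /Order.comparable.
    by rewrite (le_trans (xle _ _ zC yD zy) le).
  case/negP: (xw); rewrite /Order.comparable.
  by rewrite (le_trans (yle _ _ xC wD xw) le) orbT.
have inP v : v \in C :|: D -> v \in P /\ v != a by rewrite CDP => /setD1P[].
have [xP xa] := inP x (subsetP (subsetUl _ _) _ xC).
have [yP ya] := inP y (subsetP (subsetUr _ _) _ yD).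
have below v : v \in P -> v != a -> ~~ (v < a)%O -> (v >< a)%O.
  move=> vP va nva; rewrite /Order.comparable negb_or; apply/andP; split.
    by apply: contra nva => le; rewrite lt_neqAle va.
  by apply: contra (amax v vP) => le; rewrite lt_neqAle eq_sym va.
have [xlta|nxa] := boolP (x < a)%O.
  exact: width_two_step Cch Dch PE xlta xC xle.
have [ylta|nya] := boolP (y < a)%O.
  apply: width_two_step Dch Cch _ ylta yD _; first by rewrite [D :|: C]setUC.
  by move=> w' z' w'D z'C w'z'; apply: (yle z' w') => //; rewrite comparable_sym.
by case: (w2 x y a xP yP aP xy (below _ xP xa nxa) (below _ yP ya nya)).
Qed.

End WidthTwo.

(** * Coordinates of a conditionally URC lattice *)

Section JoinPrime.

Variables (d : Order.disp_t) (L : finTBDistrLatticeType d).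
Implicit Types a b c e p q r : L.

Definition join_prime p : bool := (p != \bot)%O &&
  [forall a, forall b, (p <= a `|` b)%O ==> (p <= a)%O || (p <= b)%O].

Lemma join_primeP p a b : join_prime p ->
  (p <= a `|` b)%O = (p <= a)%O || (p <= b)%O.
Proof.
move=> /andP[_ /forallP/(_ a)/forallP/(_ b)/implyP H].
by apply/idP/orP => [/H/orP//|[|] h]; rewrite lexU2 // h ?orbT.
Qed.

Lemma le_join_prime a b :
  (forall p, join_prime p -> (p <= a)%O -> (p <= b)%O) -> (a <= b)%O.
Proof.
move=> H; apply: contraT => nab.
pose A := [pred p | (p <= a)%O && ~~ (p <= b)%O].
have aA : A a by rewrite /A /= lexx.
case: (arg_minnP (@rank d L) aA) => p /andP[pa npb] pmin; case/negP: (npb);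
  apply: H (pa).
have below q : (q < p)%O -> (q <= b)%O.
  move=> qp; apply: contraT => nqb; have := pmin q.
  by rewrite /A /= nqb (le_trans (ltW qp) pa) leqNgt rank_lt // => /(_ isT).
rewrite /join_prime; apply/andP; split.
  by apply: contraNneq npb => ->; apply: le0x.
apply/forallP => c; apply/forallP => e; apply/implyP => pce.
apply: contraT; rewrite negb_or => /andP[npc npe].
have lt r : ~~ (p <= r)%O -> (p `&` r < p)%O.
  by move=> npr; rewrite lt_neqAle leIl andbT; apply: contra npr => /eqP/meet_idPl.
case/negP: npb; rewrite -(meet_idPl pce) meetUr leUx.
by rewrite !below ?lt.
Qed.

(** For pairwise incomparable join primes p, q and r, and for the median m,
    the elements p `|` m, q `|` m and r `|` m span a Boolean lattice of rank
    three with bottom m, in which complements are not unique. *)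
Lemma URC_width_two : conditionally_URC L ->
  forall p q r, join_prime p -> join_prime q -> join_prime r ->
    (p >< q)%O -> (p >< r)%O -> (q >< r)%O -> False.
Proof.
move=> /conditionally_URCP urc p q r pp qp rp pq pr qr.
pose m := ((p `&` q) `|` (p `&` r) `|` (q `&` r))%O.
have [[npq nqp] [npr nrp] [nqr nrq]] : [/\ ~~ (p <= q)%O /\ ~~ (q <= p)%O,
    ~~ (p <= r)%O /\ ~~ (r <= p)%O & ~~ (q <= r)%O /\ ~~ (r <= q)%O].
  by move: pq pr qr; rewrite /Order.comparable !negb_or => /andP[-> ->] /andP[-> ->] /andP[-> ->].
have npm : ~~ (p <= m)%O by rewrite !join_primeP // !lexI lexx (negPf npq) (negPf npr).
have nqm : ~~ (q <= m)%O by rewrite !join_primeP // !lexI lexx (negPf nqp) (negPf nqr).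
have nrm : ~~ (r <= m)%O by rewrite !join_primeP // !lexI lexx (negPf nrp) (negPf nrq).
have mpq : ((p `|` m) `&` (q `|` m) = m)%O.
  by rewrite -joinIl; apply/join_idPr; rewrite /m -!joinA leUl.
have mpr : ((p `|` m) `&` (r `|` m) = m)%O.
  by rewrite -joinIl; apply/join_idPr; rewrite /m lexU2 // leUr.
have mqr : ((q `|` m) `&` (r `|` m) = m)%O.
  by rewrite -joinIl; apply/join_idPr; rewrite /m leUr.
pose p' := (p `|` m)%O; pose q' := (q `|` m)%O; pose r' := (r `|` m)%O.
have incomp a b : (a `&` b = m)%O -> ~~ (a <= m)%O -> ~~ (b <= m)%O -> (a >< b)%O.
  move=> ab nam nbm; rewrite /Order.comparable negb_or; apply/andP; split.
    by apply: contra nam => /meet_idPl <-; rewrite ab.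
  by apply: contra nbm => /meet_idPr <-; rewrite ab.
have nU a b : ~~ (a <= m)%O -> ~~ (a `|` b <= m)%O by rewrite leUx negb_and => ->.
have E : [set p'; (q' `|` r')%O] = [set q'; (p' `|` r')%O].
  have mE1 : (p' `&` (q' `|` r') = m)%O by rewrite meetUr mpq mpr joinxx.
  have mE2 : (q' `&` (p' `|` r') = m)%O by rewrite meetUr mqr meetC mpq joinxx.
  apply: urc; rewrite ?mE1 ?mE2 //; last by rewrite joinCA.
    exact: (incomp _ _ mE1 (nU _ _ npm) (nU _ _ (nU _ _ nqm))).
  exact: (incomp _ _ mE2 (nU _ _ nqm) (nU _ _ (nU _ _ npm))).
have [[pE _]|[pE _]] := set2_inj E.
  by have := nU p m npm; rewrite -/p' -[p' in X in X -> _]meetxx {2}pE mpq lexx.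
have rp' : (r' <= p')%O by rewrite pE leUr.
by have := nU r m nrm; rewrite -/r' -(meet_idPr rp') mpr lexx.
Qed.

Lemma join_prime_bigjoin (E : {set L}) p : join_prime p ->
  (p <= \join_(q in E) q)%O -> exists2 q, q \in E & (p <= q)%O.
Proof.
move=> pp; elim/big_rec: _ => [|q a qE IH].
  by rewrite lex0; case/andP: (pp) => /negPf->.
by rewrite join_primeP // => /orP[pq|/IH//]; exists q.
Qed.

(** Adding join primes one at a time, a maximal one last, gives a strictly
    increasing sequence of joins. *)
Lemma join_prime_chain (E : {set L}) : (forall p, p \in E -> join_prime p) ->
  exists C : {set L}, [/\ is_chain C, #|C| = #|E|.+1 &
    forall c, c \in C -> (c <= \join_(q in E) q)%O].
Proof.
have [k] := ubnP #|E|; elim: k E => // k IH E; rewrite ltnS => Ek Ep.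
have [->|[p0 /maximal_exists[p pE pmax]]] := set_0Vmem E.
  exists [set \bot%O]; rewrite cards1 cards0; split=> //.
    by apply/is_chainP => a b /set1P-> /set1P->; apply: comparablexx.
  by move=> c /set1P->; apply: le0x.
have [||C [Cch Ccard Cle]] := IH (E :\ p).
- by move: Ek; rewrite (cardsD1 p E) pE.
- by move=> q /setD1P[_ /Ep].
pose j := (\join_(q in E) q)%O.
have jE : j = (p `|` \join_(q in E :\ p) q)%O by rewrite /j (big_setD1 p).
have Clej c : c \in C -> (c <= j)%O by move=> /Cle cj; rewrite jE lexU2 // cj orbT.
exists (j |: C); split.
- apply/is_chainP => a b; rewrite !inE /Order.comparable.
  move=> /orP[/eqP->|aC] /orP[/eqP->|bC]; rewrite ?lexx ?Clej ?orbT //.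
  by move/is_chainP: Cch; apply.
- rewrite cardsU1 Ccard [in RHS](cardsD1 p E) pE;
  case: (boolP (j \in C)) => // /Cle jle.
  have /(join_prime_bigjoin (Ep p pE))[q] : (p <= \join_(q in E :\ p) q)%O.
    by apply: le_trans jle; rewrite jE leUl.
  by move=> /setD1P[qp /pmax]; rewrite lt_neqAle eq_sym qp /= => /negbTE->.
- by move=> c /setU1P[->//|/Clej].
Qed.

Section Coordinate.

Variable C : {set L}.
Hypothesis Cprime : forall p, p \in C -> join_prime p.
Hypothesis Cchain : is_chain C.

(** The elements of the chain [C] of join primes below [a] form an initial
    segment of [C], determined by its size. *)
Definition coordinate a : nat := #|[set p in C | (p <= a)%O]|.

Lemma initial_segments a b :
  [set p in C | (p <= a)%O] \subset [set p in C | (p <= b)%O] \/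
  [set p in C | (p <= b)%O] \subset [set p in C | (p <= a)%O].
Proof.
have [|/subsetPn[p]] := boolP (_ \subset _); first by left.
rewrite !inE => /andP[pC pa]; rewrite pC /= => npb; right.
apply/subsetP => q; rewrite !inE => /andP[qC qb]; rewrite qC /=.
move/is_chainP: Cchain => /(_ p q pC qC)/orP[pq|qp]; last exact: le_trans qp pa.
by rewrite (le_trans pq qb) in npb.
Qed.

Lemma coordinate_meet a b : coordinate (a `&` b)%O = minn (coordinate a) (coordinate b).
Proof.
rewrite /coordinate; set A := [set p in C | (p <= a)%O];
  set B := [set p in C | (p <= b)%O].
have -> : [set p in C | (p <= a `&` b)%O] = A :&: B.
  by apply/setP => p; rewrite !inE lexI; case: (p \in C).
have [AB|BA] := initial_segments a b.
  by rewrite (setIidPl AB) (minn_idPl (subset_leq_card AB)).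
by rewrite (setIidPr BA) (minn_idPr (subset_leq_card BA)).
Qed.

Lemma coordinate_join a b : coordinate (a `|` b)%O = maxn (coordinate a) (coordinate b).
Proof.
rewrite /coordinate; set A := [set p in C | (p <= a)%O];
  set B := [set p in C | (p <= b)%O].
have -> : [set p in C | (p <= a `|` b)%O] = A :|: B.
  apply/setP => p; rewrite !inE; case: (boolP (p \in C)) => //= pC.
  exact/join_primeP/Cprime.
have [AB|BA] := initial_segments a b.
  by rewrite (setUidPr AB) (maxn_idPr (subset_leq_card AB)).
by rewrite (setUidPl BA) (maxn_idPl (subset_leq_card BA)).
Qed.

Lemma coordinate_eq a b p : coordinate a = coordinate b -> p \in C ->
  (p <= a)%O = (p <= b)%O.
Proof.
move=> E pC; suff /setP/(_ p) : [set p in C | (p <= a)%O] = [set p in C | (p <= b)%O].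
  by rewrite !inE pC.
apply/eqP; have [AB|BA] := initial_segments a b.
  by rewrite eqEcard AB -/(coordinate a) -/(coordinate b) E leqnn.
by rewrite eq_sym eqEcard BA -/(coordinate a) -/(coordinate b) E leqnn.
Qed.

Lemma coordinate_max a : (coordinate a <= #|C|)%N.
Proof. by apply: subset_leq_card; apply/subsetP => p; rewrite inE => /andP[]. Qed.

End Coordinate.

End JoinPrime.

(** * Conditionally URC lattices and chain ladders *)

Section LadderLattice.

Variables (d : Order.disp_t) (L : finTBDistrLatticeType d).
Implicit Types a b c g h k l : L.

(** Intervals with complementary sets are the rectangles of the grid all of
    whose vertices belong to the lattice, and a complementary set consists of
    the upper left and the lower right vertex. So complementing the interval
    from [g] or from [h] to [c] provides the required vertex. *)
Lemma complemented_diagonal (x y : L -> nat) (P : nat -> nat -> bool) :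
  planar_coordinates x y ->
  (forall i j, reflect (exists a, x a = i /\ y a = j) (P i j)) ->
  (forall a b c : L, (a < b)%O -> (b < c)%O ->
     complemented a b -> complemented b c ->
     forall g h : L, complementary_set a b [set g; h] ->
       complemented g c \/ complemented h c) ->
  diagonal_closed P.
Proof.
move=> xy PP H i0 i1 i2 j0 j1 j2 i01 i12 j01 j12.
move=> /PP[g [xg yg]] /PP[h [xh yh]] /PP[k [xk yk]] /PP[l [xl yl]].
have [xI xU yI yU xyinj] := xy.
have incomp e f : (x e < x f)%N -> (y f < y e)%N -> (e >< f)%O.
  move=> xef yfe; apply/negP => /orP[/meet_idPl E|/meet_idPr E].
    by move: yfe; rewrite -E yI; lia.
  by move: xef; rewrite -E xI; lia.
have gh : (g >< h)%O by apply: incomp; lia.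
have kl : (k >< l)%O by apply: incomp; lia.
have bE : (g `|` h)%O = (k `&` l)%O by apply: xyinj; rewrite ?xI ?xU ?yI ?yU; lia.
have [l1 _ l3 _] := incomparableP gh; have [k1 _ k3 _] := incomparableP kl.
have [|||||/complementedP|/complementedP] := H (g `&` h)%O (g `|` h)%O (k `|` l)%O _ _ _ _ g h.
- exact: lt_trans l1 l3.
- by rewrite bE; apply: lt_trans k1 k3.
- by apply/complementedP; exists g, h.
- by rewrite bE; apply/complementedP; exists k, l.
- exact/complementary_setP.
- move=> [s [t [st sI sU]]]; left; apply/PP; have := incomparable_rectangle xy st.
  rewrite sI sU => -[] [[x1 y1] [x2 y2] _]; [exists s | exists t].
    by rewrite x1 y1 xg yU yk yl; split; lia.
  by rewrite x1 y1 xg yU yk yl; split; lia.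
move=> [s [t [st sI sU]]]; right; apply/PP; have := incomparable_rectangle xy st.
rewrite sI sU => -[] [[x1 y1] [x2 y2] _]; [exists t | exists s].
  by rewrite x2 y2 yh xU xk xl; split; lia.
by rewrite x2 y2 yh xU xk xl; split; lia.
Qed.

Section Embedding.

Variables (m n : nat) (S : {set grid m n}) (f : L -> grid m n).
Hypothesis f_inj : injective f.
Hypothesis f_im : f @: [set: L] = S.
Hypothesis f_meet : {morph f : a b / (a `&` b)%O >-> (a `&` b)%O}.
Hypothesis f_join : {morph f : a b / (a `|` b)%O >-> (a `|` b)%O}.

Let x a : nat := (f a).1.
Let y a : nat := (f a).2.

Lemma embedding_coordinates : planar_coordinates x y.
Proof.
split; rewrite /x /y.
- by move=> a b; rewrite f_meet; case: (grid_meetE (f a) (f b)).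
- by move=> a b; rewrite f_join; case: (grid_joinE (f a) (f b)).
- by move=> a b; rewrite f_meet; case: (grid_meetE (f a) (f b)).
- by move=> a b; rewrite f_join; case: (grid_joinE (f a) (f b)).
- by move=> a b E E'; apply/f_inj/grid_inj.
Qed.

Lemma embedding_at_pos i j : reflect (exists a, x a = i /\ y a = j) (at_pos S i j).
Proof.
apply: (iffP (at_posP S i j)) => [[p []]|[a [xa ya]]].
  by rewrite -f_im => /imsetP[a _ ->] xa ya; exists a.
by exists (f a); rewrite -f_im imset_f.
Qed.

Lemma embedding_diagonal : diagonal_closed (at_pos S) -> forall a b c g h k l,
  rectangle x y a g h b -> rectangle x y b k l c ->
  (exists t, x t = x a /\ y t = y c) \/ (exists t, x t = x c /\ y t = y a).
Proof.
move=> diag a b c g h k l [[xg yg] [xh yh] [xab yab]] [[xk yk] [xl yl] [xbc ybc]].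
have [||||/embedding_at_pos|/embedding_at_pos] :=
  diag _ _ _ _ _ _ xab xbc yab ybc; [..|by left|by right].
- by apply/embedding_at_pos; exists g.
- by apply/embedding_at_pos; exists h.
- by apply/embedding_at_pos; exists k.
- by apply/embedding_at_pos; exists l.
Qed.

End Embedding.

(** The join primes of a conditionally URC lattice are covered by two chains;
    counting the join primes of each chain below a given element embeds the
    lattice in a grid. *)
Lemma URC_embedding : conditionally_URC L ->
  exists (m n : nat) (f : L -> grid m n),
    [/\ injective f, {morph f : a b / (a `&` b)%O >-> (a `&` b)%O},
        {morph f : a b / (a `|` b)%O >-> (a `|` b)%O}
      & full_sublattice (f @: [set: L])].
Proof.
move=> urc; pose J := [set p : L | join_prime p].
have [|C [D [CDJ CD Cch Dch]]] := @width_two_chains _ L J.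
  by move=> p q r; rewrite !inE; apply: URC_width_two.
have Cp p : p \in C -> join_prime p.
  by move=> pC; have := subsetP (subsetUl C D) _ pC; rewrite CDJ inE.
have Dp p : p \in D -> join_prime p.
  by move=> pD; have := subsetP (subsetUr C D) _ pD; rewrite CDJ inE.
have CDcard : #|J| = (#|C| + #|D|)%N.
  by rewrite -CDJ cardsU; move: CD; rewrite -setI_eq0 => /eqP->;
    rewrite cards0 subn0.
pose f a : grid #|C| #|D| := (inord (coordinate C a), inord (coordinate D a)).
have f1 a : (f a).1 = coordinate C a :> nat by rewrite inordK // ltnS coordinate_max.
have f2 a : (f a).2 = coordinate D a :> nat by rewrite inordK // ltnS coordinate_max.
have f_inj : injective f.
  move=> a b E; have E1 : coordinate C a = coordinate C b by rewrite -!f1 E.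
  have E2 : coordinate D a = coordinate D b by rewrite -!f2 E.
  have sub p : join_prime p -> (p <= a)%O = (p <= b)%O.
    move=> pp; have : p \in C :|: D by rewrite CDJ inE.
    by move=> /setUP[]; apply: coordinate_eq.
  by apply/eqP; rewrite eq_le !le_join_prime // => p /sub->.
have f_meet : {morph f : a b / (a `&` b)%O >-> (a `&` b)%O}.
  move=> a b; have [m1 m2] := grid_meetE (f a) (f b).
  by apply: grid_inj; rewrite ?m1 ?m2 ?f1 ?f2 coordinate_meet.
have f_join : {morph f : a b / (a `|` b)%O >-> (a `|` b)%O}.
  move=> a b; have [m1 m2] := grid_joinE (f a) (f b).
  by apply: grid_inj; rewrite ?m1 ?m2 ?f1 ?f2 coordinate_join.
exists #|C|, #|D|, f; split=> //; split.
  move=> _ _ /imsetP[a _ ->] /imsetP[b _ ->].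
  by rewrite -f_meet -f_join !imset_f.
have [|E [Ech Ecard _]] := @join_prime_chain _ L J.
  by move=> p; rewrite inE.
exists (f @: E); split.
- by apply: imsetS; apply: subsetT.
- apply/is_chainP => _ _ /imsetP[a aE ->] /imsetP[b bE ->].
  have le e e' : (e <= e')%O -> (f e <= f e')%O.
    by move=> /meet_idPl <-; rewrite f_meet leIr.
  move/is_chainP: Ech => /(_ a b aE bE)/orP[/le|/le] ab;
    rewrite /Order.comparable ab //.
  by rewrite orbT.
- by rewrite card_imset // Ecard CDcard.
Qed.

End LadderLattice.

Theorem theorem2p1 (K : fieldType) (d : Order.disp_t)
    (L : finTBDistrLatticeType d) (vle : rel L) (vle_rank : rank_order vle) :
  [<->
   exists G : seq {mpoly K[#|L|]},
     reduced_groebner_basis (lex_lt vle) G (hibi_ideal L K) /\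
     same_up_to_sign (fun g => g \in G) (hibi_relation L K);
   hibi_relations_indispensable L K /\
   exists G : seq {mpoly K[#|L|]},
     reduced_groebner_basis (lex_lt vle) G (hibi_ideal L K) /\
     (forall g, g \in G -> msize g = 3%N);
   conditionally_URC L /\
   forall a b c : L, (a < b)%O -> (b < c)%O ->
     complemented a b -> complemented b c ->
     forall g h : L, complementary_set a b [set g; h] ->
       complemented g c \/ complemented h c;
   exists (m n : nat) (S : {set grid m n}),
     [/\ chain_ladder S, forall p, ~~ critical_corner S p
       & lattice_isomorphic L S]].
Proof.
tfae.
- move=> [G [Gred Ghibi]]; split.
    exact/URC_indispensable/(hibi_basis_URC vle_rank Gred Ghibi).
  by exists G; split=> //; apply: hibi_basis_msize Ghibi.
- move=> [ind [G [Gred G3]]]; have urc := indispensable_URC ind.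
  split=> // a b c _ bc _ cbc g h.
  exact: (quadratic_basis_complemented vle_rank urc Gred G3 bc cbc).
- move=> [urc comp]; have [m [n [f [f_inj f_meet f_join Sfull]]]] := URC_embedding urc.
  exists m, n, (f @: [set: L]).
  have [|ladder ncrit] := diagonal_chain_ladder Sfull; last by split=> //; exists f.
  apply: complemented_diagonal comp.
    exact: (embedding_coordinates f_inj f_meet f_join).
  exact: embedding_at_pos.
move=> [m [n [S [ladder ncrit [f [f_inj f_im f_meet f_join]]]]]].
have xy := embedding_coordinates f_inj f_meet f_join.
have diag := embedding_diagonal f_im (chain_ladder_diagonal ladder ncrit).
exists (hibi_seq K L); split; last exact: hibi_seq_relations.
exact: (hibi_seq_reduced K vle_rank xy diag).
Qed.
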